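(* Let $n\ge 1$. There exist positive constants $k_l, k_u$ and $t_0\ge 0$, depending only on $n$, such that for all $t>t_0$ $$ n-\frac{k_l}{t\, e^{t/(2n)}}\ \le\ \dim\big(\mathbf{Bad}^n_{\mathbb R^n}(e^{-t/n})\big)\ \le\ n-\frac{k_u}{t\, e^{(n+1)t}} . $$
   Context: $\dim$ denotes Hausdorff dimension and $\|\cdot\|$ is the supremum norm on $\mathbb R^n$. For $c>0$, $\mathbf{Bad}^n_{\mathbb R^n}(c)$ is the set of badly approximable vectors with approximation constant at least $c$, i.e. the set of $\bar x\in\mathbb R^n$ such that $$\Big\|\bar x-\frac{\bar p}{q}\Big\|\ \ge\ \frac{c}{q^{1+1/n}}\qquad\text{for all } q\in\mathbb N=\{1,2,\dots\},\ \bar p\in\mathbb Z^n .$$ *)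

(* Defs.v *)
From HB Require Import structures.
From mathcomp Require Import all_boot all_order all_algebra.
From mathcomp Require Import all_classical all_reals all_analysis.

Set Implicit Arguments.
Unset Strict Implicit.
Unset Printing Implicit Defensive.

Import Order.TTheory GRing.Theory Num.Theory.
Import numFieldNormedType.Exports.

Local Open Scope classical_set_scope.
Local Open Scope ring_scope.

Section hausdorff.
Context {R : realType} {V : normedZmodType R}.
Local Open Scope ereal_scope.

Implicit Types (A B : set V) (s delta : R).

(* The value on the empty set is -oo; it is only used for comparisons
   with an upper bound and for nonempty sets. *)
Definition diam B : \bar R :=
  ereal_sup [set (`|z.1 - z.2|%R)%:E | z in B `*` B].

(* diam(B)^s, with the conventions 0^0 = 1 and diam(set0)^s = 0 for all s,
   so that the case s = 0 gives the counting measure. *)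
Definition hgauge s B : \bar R :=
  if B == set0 then 0 else poweR (diam B) s.

(* Covers are indexed by nat; finite covers are included by padding with set0. *)
Definition hausdorff_premeasure s delta A : \bar R :=
  ereal_inf [set \sum_(0 <= i <oo) hgauge s (U i) | U in
    [set U : nat -> set V |
      A `<=` \bigcup_i U i /\ forall i, diam (U i) <= delta%:E]].

Definition hausdorff_measure s A : \bar R :=
  ereal_sup [set hausdorff_premeasure s delta A | delta in [set d : R | (0 < d)%R]].

Definition hausdorff_dim A : \bar R :=
  ereal_inf [set s%:E | s in [set s : R |
    (0 <= s)%R /\ hausdorff_measure s A = 0]].

End hausdorff.

(* The norm on 'rV[R]_n is the library one, i.e. the supremum norm. *)
Definition Bad (R : realType) (n : nat) (c : R) : set 'rV[R]_n :=
  [set x | forall (q : nat) (p : 'rV[int]_n), (0 < q)%N ->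
    c / q%:R `^ (1 + n%:R^-1) <=
      `| x - q%:R^-1 *: map_mx (fun z : int => z%:~R) p |].

(* Main.v *)
(* Lower bound. Put M ~ c^(-1/2) and subdivide a cube M-adically. The rationals p/q near a
   cube of side r ~ M^-k with q^(1+1/n) in [M^k, M^(k+1)) lie on one hyperplane (simplex
   lemma), and the points that are too close to them lie in a neighbourhood of it whose
   width is comparable to the side r / M of the subcubes. So only O(M^(n-1)) of the M^n
   subcubes have to be discarded, and the resulting Cantor subset of Bad(c) has dimension
   at least n + log(1 - O(1/M)) / log M.
   Upper bound. Put M ~ c^-(n+1). If x in Bad(c) lies near the centre of a cube of side r,
   Dirichlet's theorem gives p/q with |x - p/q| <= 1/(c^n Q^(n+1)) and q <= Q^n; taking
   Q^(n+1) ~ 1/(c^n r) puts p/q in the cube, and the ball of radius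
   c / q^(1+1/n) >= c^(n+1) r around it, which misses Bad(c), contains a subcube of side
   r / M. So at most M^n - 1 of the M^n subcubes meet Bad(c), whence the dimension is at
   most log(M^n - 1) / log M. *)
Require Import Defs.
From mathcomp Require Import all_boot all_order all_algebra.
From mathcomp Require Import all_classical all_reals all_analysis.
From mathcomp Require Import perm.
From mathcomp Require Import ring lra zify.
Import Order.TTheory GRing.Theory Num.Theory.
Import numFieldNormedType.Exports.
Local Open Scope classical_set_scope.
Local Open Scope ring_scope.
Set Implicit Arguments.
Unset Strict Implicit.
Unset Printing Implicit Defensive.

(** * Hausdorff premeasures *)

Section HausdorffPremeasure.
Context {R : realType} {V : normedZmodType R}.
Implicit Types (A B : set V) (s d : R).
Local Open Scope ereal_scope.

Lemma diam_leP B d :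
  diam B <= d%:E <-> forall x y, B x -> B y -> (`|x - y| <= d)%R.
Proof.
split=> [Bd x y Bx By|H].
  by rewrite -lee_fin; apply: le_trans Bd; apply: ereal_sup_ubound; exists (x, y).
by apply: ge_ereal_sup => _ [[x y] [/= Bx By] <-]; rewrite lee_fin; exact: H.
Qed.

Lemma diam_ge0 B : B !=set0 -> 0 <= diam B.
Proof.
move=> [x Bx]; apply: ereal_sup_ubound; exists (x, x) => //=.
by rewrite subrr normr0.
Qed.

Lemma hgauge_ge0 s B : 0 <= hgauge s B.
Proof. by rewrite /hgauge; case: ifP => // _; exact: poweR_ge0. Qed.

Lemma hgauge_set0 s : hgauge s (set0 : set V) = 0.
Proof. by rewrite /hgauge eqxx. Qed.

Lemma hgauge_le s d B : (0 <= s)%R -> diam B <= d%:E ->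
  hgauge s B <= (d `^ s)%:E.
Proof.
move=> s0 Bd; rewrite /hgauge; case: ifPn => [_|/set0P /diam_ge0 B0].
  by rewrite lee_fin powR_ge0.
rewrite -poweR_EFin gt0_ler_poweR//.
  by rewrite in_itv/= B0 leey.
by rewrite in_itv/= leey andbT (le_trans B0).
Qed.

Lemma diam_set0_le d : diam (set0 : set V) <= d%:E.
Proof. by apply/diam_leP. Qed.

Lemma hausdorff_premeasure_ge0 s d A : 0 <= hausdorff_premeasure s d A.
Proof.
apply: le_ereal_inf_tmp => _ [U _ <-].
by apply: nneseries_ge0 => i _ _; exact: hgauge_ge0.
Qed.

Lemma le_hausdorff_premeasure s d A B : A `<=` B ->
  hausdorff_premeasure s d A <= hausdorff_premeasure s d B.
Proof.
move=> AB; apply: le_ereal_inf_tmp => _ [U [BU Ud] <-].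
apply: ereal_inf_lbound; exists U => //; split => //.
exact: subset_trans BU.
Qed.

Lemma hausdorff_premeasure_le_gauge s d A : diam A <= d%:E ->
  hausdorff_premeasure s d A <= hgauge s A.
Proof.
move=> Ad; apply: ereal_inf_lbound.
exists (fun i => if i is 0%N then A else set0).
  split; first by move=> x Ax; exists 0%N.
  by case=> // k; exact: diam_set0_le.
rewrite nneseries_recl// => [|k _]; last exact: hgauge_ge0.
rewrite eseries0 ?adde0// => i i0 _.
by rewrite -(prednK i0) hgauge_set0.
Qed.

Lemma hausdorff_premeasure_set0 s d : hausdorff_premeasure s d (set0 : set V) = 0.
Proof.
apply/eqP; rewrite eq_le hausdorff_premeasure_ge0 andbT -(hgauge_set0 s).
exact/hausdorff_premeasure_le_gauge/diam_set0_le.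
Qed.

(** Covers of the [A n], optimal up to [e / 2 ^ n.+1], merge into one cover along a bijection
    between [nat] and [nat * nat]. *)
Lemma hausdorff_premeasure_bigcup s d (A : nat -> set V) :
  hausdorff_premeasure s d (\bigcup_n A n) <=
  \sum_(0 <= n <oo) hausdorff_premeasure s d (A n).
Proof.
(* An infinite term makes the bound trivial; otherwise every infimum is finite, hence nearly
   attained. *)
have [[i ioo]|] := pselect (exists i, hausdorff_premeasure s d (A i) = +oo).
  rewrite (eseries_pinfty _ _ ioo) ?leey// => n _.
  by rewrite -ltNye (lt_le_trans _ (hausdorff_premeasure_ge0 _ _ _)).
rewrite -forallNE => Aoo.
suff add2e (e : {posnum R}) : hausdorff_premeasure s d (\bigcup_n A n) <=
    \sum_(0 <= n <oo) hausdorff_premeasure s d (A n) + e%:num%:E.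
  by apply/lee_addgt0Pr => _/posnumP[].
rewrite (le_trans _ (epsilon_trick _ _ _))//; last first.
  by move=> n; exact: hausdorff_premeasure_ge0.
pose P n (U : nat -> set V) :=
  [/\ A n `<=` \bigcup_i U i, forall i, diam (U i) <= d%:E &
  \sum_(0 <= k <oo) hgauge s (U k) <=
    hausdorff_premeasure s d (A n) + (e%:num / (2 ^ n.+1)%:R)%:E].
have [G PG] : {G : nat -> nat -> set V & forall n, P n (G n)}.
  apply: (@choice _ _ P) => n.
  have en : (0 < e%:num / (2 ^ n.+1)%:R :> R)%R by [].
  have fin : hausdorff_premeasure s d (A n) \is a fin_num.
    rewrite ge0_fin_numE ?hausdorff_premeasure_ge0// ltey.
    by apply/eqP; exact: Aoo.
  have [_ [U [AU Ud] <-] /ltW ?] := lb_ereal_inf_adherent en fin.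
  by exists U.
have /card_esym/ppcard_eqP[f] := card_nat2.
apply: (@le_trans _ _ (\sum_(0 <= k <oo) hgauge s (uncurry G (f k)))).
  apply: ereal_inf_lbound; exists (uncurry G \o f) => //; split => [x|i /=].
    move=> [n _ Anx]; have [GA _ _] := PG n.
    have [j _ Gx] := GA _ Anx; exists (f^-1%FUN (n, j)) => //=.
    by rewrite invK ?inE.
  by rewrite /uncurry; case: (f i) => a b /=; have [_ ->] := PG a.
rewrite nneseries_esumT; last by move=> k; exact: hgauge_ge0.
rewrite (_ : esum _ _ = \esum_(i in setT) hgauge s (uncurry G i)); last first.
  by rewrite (@reindex_esum _ _ _ setT setT f (fun i => hgauge s (uncurry G i))).
rewrite (_ : esum _ _ = \esum_(i in setT) \esum_(j in setT) hgauge s (G i j));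
  last first.
  rewrite esum_esum; last by move=> *; exact: hgauge_ge0.
  rewrite (_ : _ `*`` _ = setT); last exact/seteqP.
  by apply: eq_esum => -[].
rewrite -nneseries_esumT; last first.
  by move=> k; apply: esum_ge0 => *; exact: hgauge_ge0.
apply: lee_nneseries => [i _ _|i _].
  by apply: esum_ge0 => *; exact: hgauge_ge0.
rewrite -nneseries_esumT => [|k]; last exact: hgauge_ge0.
by case: (PG i).
Qed.

Lemma hausdorff_measure_eq0P s A : hausdorff_measure s A = 0 <->
  forall d, (0 < d)%R -> hausdorff_premeasure s d A = 0.
Proof.
split=> [H d d0|H].
  apply/eqP; rewrite eq_le hausdorff_premeasure_ge0 andbT -H.
  by apply: ereal_sup_ubound; exists d.
apply/eqP; rewrite eq_le; apply/andP; split.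
  by apply: ge_ereal_sup => _ [d d0 <-]; rewrite H.
by rewrite -(H _ ltr01); apply: ereal_sup_ubound; exists 1%R => //=.
Qed.

Lemma hausdorff_premeasureU s d A B : hausdorff_premeasure s d (A `|` B) <=
  hausdorff_premeasure s d A + hausdorff_premeasure s d B.
Proof.
rewrite -bigcup2E; apply: le_trans (hausdorff_premeasure_bigcup _ _ _) _.
rewrite (nneseries_split 0 2) => [|k _]; last exact: hausdorff_premeasure_ge0.
rewrite add0n eseries0 => [|[|[|k]] //= _ _].
  by rewrite adde0 big_nat_recl// big_nat1.
exact: hausdorff_premeasure_set0.
Qed.

Lemma hausdorff_premeasure_bigsetU (I : finType) (P : pred I) (A : I -> set V)
    s d : hausdorff_premeasure s d (\big[setU/set0]_(i | P i) A i) <=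
  \sum_(i | P i) hausdorff_premeasure s d (A i).
Proof.
apply: (big_rec2 (fun (B : set V) x => hausdorff_premeasure s d B <= x)).
  by rewrite hausdorff_premeasure_set0.
move=> i B x _ Bx; apply: le_trans (hausdorff_premeasureU _ _ _ _) _.
by rewrite leeD2l.
Qed.

Lemma hausdorff_premeasure_null_bigcup (T : countType) (A : T -> set V) s d :
  (forall t, hausdorff_premeasure s d (A t) = 0) ->
  hausdorff_premeasure s d (\bigcup_t A t) = 0.
Proof.
move=> A0; apply/eqP; rewrite eq_le hausdorff_premeasure_ge0 andbT.
pose A' k := if unpickle k is Some t then A t else set0.
have sub : \bigcup_t A t `<=` \bigcup_k A' k.
  by move=> x [t _ Ax]; exists (pickle t) => //; rewrite /A' pickleK.
apply: le_trans (le_hausdorff_premeasure _ _ sub) _.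
apply: le_trans (hausdorff_premeasure_bigcup _ _ _) _.
rewrite eseries0// => k _ _; rewrite /A'; case: unpickle => [t|] //.
exact: hausdorff_premeasure_set0.
Qed.

End HausdorffPremeasure.

(** * Cells of the M-adic subdivision *)

Section Cells.
Context {R : realType} {n M : nat}.
Context (M_gt0 : (0 < M)%N).
Notation digit := {ffun 'I_n -> 'I_M}.
Implicit Types (x y z : 'rV[R]_n) (rho : R) (w v : seq digit) (b : digit).

(* The most recent digit of a word is its head. *)
Fixpoint cell_index w (j : 'I_n) : nat :=
  if w is b :: w' then (cell_index w' j * M + b j)%N else 0%N.

Definition cell_side rho (k : nat) : R := rho / M%:R ^+ k.

(** Closed on both sides, so that nested cells have a common point. Neighbours share boundary
    points, which is harmless: only coverings and upper counts of cells are needed. *)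
Definition cell z rho w : set 'rV[R]_n :=
  [set x | forall j, (cell_index w j)%:R * cell_side rho (size w)
     <= x 0 j - z 0 j <= (cell_index w j).+1%:R * cell_side rho (size w)].

Lemma rV_norm_leP x (e : R) : 0 <= e -> `|x| <= e <-> forall j, `|x 0 j| <= e.
Proof.
move=> e0; rewrite [`|x|]/Num.Def.normr/= mx_normrE; split=> [H j|H].
  by apply: le_trans H; apply: (le_bigmax _ (fun ij => `|x ij.1 ij.2|) (0, j)).
by apply: bigmax_le => // -[i j] _; rewrite /= ord1.
Qed.

Lemma cell_side_gt0 rho k : 0 < rho -> 0 < cell_side rho k.
Proof. by move=> ?; rewrite divr_gt0// exprn_gt0// ltr0n. Qed.

Lemma cell_sideS rho k : cell_side rho k = M%:R * cell_side rho k.+1.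
Proof.
rewrite /cell_side exprS invfM [RHS]mulrCA; congr *%R.
by rewrite mulrA divff ?mul1r// pnatr_eq0 -lt0n.
Qed.

(** Each coordinate of the index is a base [M] expansion, whose last digit is its residue mod
    [M]. *)
Lemma cell_index_inj v w :
  size v = size w -> cell_index v =1 cell_index w -> v = w.
Proof.
elim: v w => [|b v IH] [|c w]//= [sz] E.
have Eb : b = c.
  apply/ffunP => j; apply: val_inj => /=.
  have := congr1 (modn^~ M) (E j) => /=.
  by rewrite !modnMDl !modn_small.
rewrite Eb; congr (_ :: _); apply: IH => // j.
have /eqP := E j; rewrite Eb eqn_add2r eqn_pmul2r//.
by move=> /eqP.
Qed.

Lemma cell_cons_sub z rho b w : 0 < rho ->
  cell z rho (b :: w) `<=` cell z rho w.
Proof.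
move=> rho0 x Hx j; have /andP[/= lo hi] := Hx j.
have s0 := cell_side_gt0 (size w).+1 rho0.
rewrite cell_sideS; apply/andP; split.
  apply: le_trans lo; rewrite mulrA ler_pM2r// -natrM ler_nat.
  exact: leq_addr.
apply: le_trans hi _; rewrite mulrA ler_pM2r// -natrM ler_nat.
by rewrite mulSn [(M + _)%N]addnC -addnS leq_add2l.
Qed.

Lemma unit_subdivision (a : R) : 0 <= a <= M%:R ->
  exists i : 'I_M, i%:R <= a <= i.+1%:R.
Proof.
move=> /andP[a0 aM]; have [am|am] := ltP a M%:R.
  have := truncn_itv a0 => /andP[lo hi].
  have tM : (Num.truncn a < M)%N by rewrite -(ltr_nat R) (le_lt_trans lo).
  by exists (Ordinal tM); rewrite /= lo ltW.
(* Here [a = M], the right end of the last interval. *)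
have pM : (M.-1 < M)%N by rewrite prednK.
exists (Ordinal pM); rewrite /= prednK// aM andbT (le_trans _ am)//.
by rewrite ler_nat leq_pred.
Qed.

Lemma cell_cons_cover z rho w x : 0 < rho -> cell z rho w x ->
  exists b, cell z rho (b :: w) x.
Proof.
move=> rho0 Hx; have s0 := cell_side_gt0 (size w).+1 rho0.
have H j : exists i : 'I_M, i%:R <=
    (x 0 j - z 0 j) / cell_side rho (size w).+1 - (cell_index w j * M)%:R <= i.+1%:R.
  apply: unit_subdivision.
  have /andP[] := Hx j; rewrite (cell_sideS _ (size w)).
  move: (cell_side _ _) s0 => s s0; rewrite !mulrA.
  rewrite -(ler_pdivlMr _ _ s0) -(ler_pdivrMr _ _ s0) natrM -natr1 => lo hi.
  by apply/andP; split; lra.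
have [f Hf] := choice H.
exists (finfun f) => j /=; rewrite ffunE -(ler_pdivlMr _ _ s0) -(ler_pdivrMr _ _ s0).
have /andP[] := Hf j; rewrite -addnS !natrD => lo hi.
by apply/andP; split; lra.
Qed.

Lemma cell_dist z rho w x y : 0 < rho -> cell z rho w x -> cell z rho w y ->
  forall j, `|x 0 j - y 0 j| <= cell_side rho (size w).
Proof.
move=> rho0 Hx Hy j; have s0 := cell_side_gt0 (size w) rho0.
have := Hx j; have := Hy j; rewrite -natr1 mulrDl mul1r ler_norml.
move=> /andP[a1 a2] /andP[b1 b2]; apply/andP; split; lra.
Qed.

(** The extra 1 in [m.+1] is the width of the cell of [w], as [y] may lie at its upper face. *)
Lemma cell_index_dist z rho v w x y j (m : nat) : 0 < rho -> size v = size w ->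
  cell z rho v x -> cell z rho w y ->
  x 0 j - y 0 j <= m%:R * cell_side rho (size w) ->
  (cell_index v j <= cell_index w j + m.+1)%N.
Proof.
move=> rho0 sz Hx Hy xy; have s0 := cell_side_gt0 (size w) rho0.
have := Hx j; have := Hy j; rewrite sz => /andP[_ a2] /andP[b1 _].
rewrite -(ler_nat R) -(ler_pM2r s0) natrD -(natr1 m).
move: a2; rewrite -natr1 => a2; lra.
Qed.

(* Indices of two such cells differ by at most 2, so their residues mod 3 determine them. *)
Lemma card_cells_meeting z rho k (U : set 'rV[R]_n) : 0 < rho ->
  (forall x y, U x -> U y -> `|x - y| <= cell_side rho k) ->
  (#|[set v : k.-tuple digit | `[< cell z rho v `&` U !=set0 >]]%SET| <= 3 ^ n)%N.
Proof.
move=> rho0 HU.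
pose h (v : k.-tuple digit) : {ffun 'I_n -> 'I_3} := [ffun j => inord (cell_index v j %% 3)].
have s0 := cell_side_gt0 k rho0.
rewrite -[X in (_ <= X)%N](_ : #|{ffun 'I_n -> 'I_3}| = _); last first.
  by rewrite card_ffun !card_ord.
rewrite -(@card_in_imset _ _ h) ?max_card// => u v.
rewrite !inE; move=> [x [ux Ux]] [y [vy Uy]] huv.
apply: val_inj; apply: cell_index_inj; first by rewrite !size_tuple.
move=> j; have := congr1 (fun f : {ffun 'I_n -> 'I_3} => val (f j)) huv.
rewrite !ffunE /= !inordK ?ltn_mod// => Emod.
have near x' y' : U x' -> U y' -> x' 0 j - y' 0 j <= 1%:R * cell_side rho k.
  move=> Ux' Uy'; rewrite mul1r.
  have /rV_norm_leP/(_ j) := HU _ _ Ux' Uy'; rewrite !mxE => /(_ (ltW s0)).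
  exact: le_trans (ler_norm _).
have uv : (cell_index u j <= cell_index v j + 2)%N.
  apply: cell_index_dist ux vy _ => //; first by rewrite !size_tuple.
  by rewrite size_tuple; exact: near.
have vu : (cell_index v j <= cell_index u j + 2)%N.
  apply: cell_index_dist vy ux _ => //; first by rewrite !size_tuple.
  by rewrite size_tuple; exact: near.
move: Emod uv vu; clear.
move: (cell_index u j) (cell_index v j) => a b; lia.
Qed.

End Cells.
Arguments cell_side {R} M rho k.

(** * The mass distribution principle *)

(** The total weight of all children of [w] is at most [N] times that of [w], and at least [N]
    children are good, so the lightest good child weighs no more than [w]. Always moving there keeps
    the weight below 1. *)
Lemma supermartingale_escape (R : realType) (B : finType) (N : nat)
    (good : seq B -> {set B}) (phi : nat -> seq B -> \bar R) :
  (0 < N)%N -> (forall w, (N <= #|good w|)%N) ->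
  (forall i w, 0 <= phi i w)%E ->
  (forall i w, \sum_b phi i (b :: w) <= N%:R%:E * phi i w)%E ->
  (\sum_(0 <= i <oo) phi i [::] < 1)%E ->
  exists f : nat -> seq B, f 0%N = [::] /\
    forall k, (exists2 b, b \in good (f k) & f k.+1 = b :: f k) /\
              (\sum_(0 <= i <oo) phi i (f k) < 1)%E.
Proof.
move=> N0 goodN phi0 phiS phi1.
pose Phi w : \bar R := (\sum_(0 <= i <oo) phi i w)%E.
have Phi0 w : (0 <= Phi w)%E by apply: nneseries_ge0.
have step w : exists b, b \in good w /\ (Phi (b :: w) <= Phi w)%E.
  have [b0 gb0] : exists b0, b0 \in good w.
    by apply/set0Pn; rewrite -card_gt0 (leq_trans N0).
  pose b := [arg min_(b < b0 | b \in good w) Phi (b :: w)]%O.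
  have [gb minb] : b \in good w /\
      forall b', b' \in good w -> (Phi (b :: w) <= Phi (b' :: w))%E.
    by rewrite /b; case: Order.TotalTheory.arg_minP => // i gi mi.
  exists b; split => //.
  rewrite -(@lee_pmul2l _ N%:R%:E)// ?lte_fin ?ltr0n//.
  apply: (@le_trans _ _ (\sum_b Phi (b :: w))%E).
    apply: (@le_trans _ _ (\sum_(b' in good w) Phi (b :: w))%E).
      have -> : (\sum_(b' in good w) Phi (b :: w) =
          #|good w|%:R%:E * Phi (b :: w))%E by rewrite mule_natl sumr_const.
      by rewrite lee_wpmul2r// lee_fin ler_nat.
    apply: (@le_trans _ _ (\sum_(b' in good w) Phi (b' :: w))%E).
      exact: lee_sum.
    by rewrite [leRHS](bigID (mem (good w)))/= leeDl// sume_ge0.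
  rewrite /Phi -nneseries_sum// -nneseriesZl//.
  by apply: lee_nneseries => [i _ _|i _]; [exact: sume_ge0|exact: phiS].
have [g Hg] := choice step.
pose f := fix f k := if k is k'.+1 then g (f k') :: f k' else [::].
exists f; split => // k; split; first by exists (g (f k)) => //; case: (Hg (f k)).
elim: k => [//|k IH]; apply: le_lt_trans IH.
by case: (Hg (f k)).
Qed.

Section NestedCells.
Context {R : realType} {n M : nat}.
Context (M_gt0 : (0 < M)%N).
Notation digit := {ffun 'I_n -> 'I_M}.

(** In each coordinate the lower ends increase and stay below all upper ends; their supremum gives
    the common point. *)
Lemma cell_nested (z : 'rV[R]_n) (rho : R) (f : nat -> seq digit) : 0 < rho ->
  (forall k, exists b, f k.+1 = b :: f k) ->
  exists x, forall k, cell z rho (f k) x.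
Proof.
move=> rho0 fS.
pose lo k j : R := (cell_index (f k) j)%:R * cell_side M rho (size (f k)).
pose hi k j : R := (cell_index (f k) j).+1%:R * cell_side M rho (size (f k)).
have lohi k j : lo k j <= hi k j.
  by rewrite ler_pM2r ?ler_nat// cell_side_gt0.
have step k j : lo k j <= lo k.+1 j /\ hi k.+1 j <= hi k j.
  have [b fk] := fS k.
  have s0 := cell_side_gt0 M_gt0 (size (f k)).+1 rho0.
  rewrite /lo /hi fk (cell_sideS M_gt0 _ (size (f k))) /=.
  move: (cell_side _ _ _) s0 => s s0; rewrite !mulrA !ler_pM2r// -!natrM.
  rewrite !ler_nat; split; first exact: leq_addr.
  by rewrite mulSn [(M + _)%N]addnC -addnS leq_add2l.
have lo_mono j k l : (k <= l)%N -> lo k j <= lo l j.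
  move=> /subnKC <-; elim: (l - k)%N => [|i IH]; first by rewrite addn0.
  by rewrite addnS (le_trans IH)//; case: (step (k + i)%N j).
have hi_mono j k l : (k <= l)%N -> hi l j <= hi k j.
  move=> /subnKC <-; elim: (l - k)%N => [|i IH]; first by rewrite addn0.
  by rewrite addnS (le_trans _ IH)//; case: (step (k + i)%N j).
have lo_le_hi k l j : lo k j <= hi l j.
  apply: (@le_trans _ _ (lo (maxn k l) j)); first exact/lo_mono/leq_maxl.
  by apply: (le_trans (lohi _ _)); exact/hi_mono/leq_maxr.
have ubS j k : ubound [set lo k j | k in setT] (hi k j).
  by move=> _ [l _ <-].
exists (\row_j (z 0 j + sup [set lo k j | k in setT])) => k j.
rewrite mxE addrC addrA addNr add0r; apply/andP; split.
  by apply: ub_le_sup; [exists (hi 0%N j)|exists k].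
by apply: ge_sup; [exists (lo 0%N j), 0%N|exact: ubS].
Qed.

(* The slack [e] is for sets of diameter 0, whose gauge vanishes when [s > 0]. *)
Lemma gauge_level (rho s : R) (N : nat) (U : set 'rV[R]_n) (e : R) :
  0 < rho -> 0 <= s -> (1 < M)%N -> (1 < N)%N -> M%:R `^ s <= N%:R -> 0 < e ->
  U !=set0 -> (diam U <= rho%:E)%E ->
  exists k, (diam U <= (cell_side M rho k)%:E)%E /\
    (((N%:R ^- k)%:E <= ((M%:R / rho) `^ s)%:E * hgauge s U + e%:E)%E).
Proof.
move=> rho0 s0 M1 N1 MN e0 U0 Urho.
have N0 : 0 < N%:R :> R by rewrite ltr0n ltnW.
have M0 : 0 < M%:R :> R by rewrite ltr0n ltnW.
have pow_gt (m k : nat) : (1 < m)%N -> k%:R < m%:R ^+ k :> R.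
  by move=> m1; rewrite -natrX ltr_nat ltn_expl.
have [d dU] : exists d : R, diam U = d%:E.
  have /fineK <- : diam U \is a fin_num.
    by rewrite ge0_fin_numE ?diam_ge0// (le_lt_trans Urho) ?ltey.
  by eexists.
have d0 : 0 <= d by rewrite -lee_fin -dU diam_ge0.
have hU : hgauge s U = (d `^ s)%:E.
  by rewrite /hgauge ifF ?dU//; apply/negbTE/set0P.
rewrite hU dU; move: Urho; rewrite dU lee_fin => drho.
have [d_eq0|d_neq0] := eqVneq d 0.
  (* Every level is wide enough for diameter 0; this one has [N ^- k < e] because
     [e^-1 < k < N ^ k]. *)
  exists (Num.truncn e^-1).+1; split.
    by rewrite lee_fin d_eq0 ltW// cell_side_gt0// ltnW.
  rewrite -EFinM -EFinD lee_fin -[leLHS]add0r lerD ?mulr_ge0 ?powR_ge0//.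
  rewrite -[leRHS]invrK lef_pV2 ?posrE ?invr_gt0 ?exprn_gt0//.
  apply/ltW/(lt_trans _ (pow_gt _ _ N1)).
  exact: truncnS_gt.
have {d_neq0}d0 : 0 < d by rewrite lt_neqAle eq_sym d_neq0.
(* The last level whose cells are at least as wide as [d]. Then [rho / M ^ k.+1 < d], so [M ^- k] is
   at most [M / rho * d]; raising this to the power [s] and using [M ^ s <= N] bounds [N ^- k]. *)
pose P k := d <= cell_side M rho k.
have P0 : P 0%N by rewrite /P /cell_side expr0 divr1.
have Pbound k : P k -> (k <= Num.truncn (rho / d))%N.
  rewrite /P /cell_side ler_pdivlMr ?exprn_gt0// mulrC -ler_pdivlMr// => H.
  have := lt_le_trans (pow_gt _ _ M1) (le_trans H (ltW (truncnS_gt _))).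
  by rewrite ltr_nat ltnS.
have exP : exists k, P k by exists 0%N.
case: (ex_maxnP exP Pbound) => k Pk maxk.
exists k; split; first by rewrite lee_fin.
have dk : cell_side M rho k.+1 < d.
  by rewrite ltNge; apply/negP => /maxk; rewrite ltnn.
rewrite -EFinM -EFinD lee_fin -[leLHS]addr0 lerD ?(ltW e0)//.
have Mrho0 : 0 <= M%:R / rho by rewrite divr_ge0 ?ltW.
rewrite -powRM ?(ltW d0)//.
apply: (@le_trans _ _ ((M%:R ^+ k) `^ s)^-1).
  rewrite -(powR_mulrn _ (ltW M0)) powRAC powR_mulrn ?powR_ge0//.
  have Ms0 : 0 < M%:R `^ s :> R by rewrite powR_gt0.
  rewrite lef_pV2 ?posrE ?exprn_gt0//.
  by rewrite lerXn2r// nnegrE ltW.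
have Mrhod0 : 0 <= M%:R / rho * d by rewrite mulr_ge0// ltW.
have Mk0 : 0 <= M%:R ^+ k :> R by rewrite exprn_ge0// ltW.
rewrite -div1r ler_pdivrMr ?powR_gt0 ?exprn_gt0// -powRM//.
apply: (@le_trans _ _ (1 `^ s)); first by rewrite powR1.
apply: ge0_ler_powR; rewrite ?nnegrE ?(mulr_ge0 Mrhod0 Mk0)//.
have -> : M%:R / rho * d * M%:R ^+ k = d * M%:R ^+ k.+1 / rho by rewrite exprS; ring.
rewrite ler_pdivlMr// mul1r.
by move/ltW: dk; rewrite /cell_side ler_pdivrMr ?exprn_gt0.
Qed.

Definition cell_hits (z : 'rV[R]_n) (rho : R) (U : set 'rV[R]_n) k : {set k.-tuple digit} :=
  [set v : k.-tuple digit | `[< cell z rho v `&` U !=set0 >]]%SET.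

(* Does not increase on average from a word to any [N] of its children, whichever are
   chosen; hence, for a countable family of sets [U] of small total weight, always moving
   to the child of least total weight yields a path whose cells avoid all of them. *)
Definition hit_weight z rho (N : nat) U k (w : seq digit) : \bar R :=
  if (size w <= k)%N then
    (#|[set v in cell_hits z rho U k | suffix w v]%SET|%:R / N%:R ^+ (k - size w))%:E
  else 0%E.

Lemma hit_weight_ge0 z rho N U k w : (0 <= hit_weight z rho N U k w)%E.
Proof.
by rewrite /hit_weight; case: ifP => // _; rewrite lee_fin divr_ge0 ?exprn_ge0.
Qed.

(** Words grow at the head, so descendants of [w] are the words with suffix [w]; each proper one
    descends from a single child. *)
Lemma suffix_cons_inj (T : eqType) (b c : T) (w v : seq T) :
  suffix (b :: w) v -> suffix (c :: w) v -> b = c.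
Proof.
move=> /suffixP[s ->] /suffixP[t /(congr1 rev)/eqP].
rewrite -!cat_rcons !rev_cat !rev_rcons eqseq_cat// eqxx eqseq_cons /=.
by move=> /andP[/eqP].
Qed.

(** Above level [k], each hit cell below [w] is counted under at most one child, and the exponent of
    [N] drops by one. From level [k] on, the children have weight 0. *)
Lemma hit_weight_sum z rho (N : nat) U k w : (0 < N)%N ->
  (\sum_b hit_weight z rho N U k (b :: w) <= N%:R%:E * hit_weight z rho N U k w)%E.
Proof.
move=> N0; have N0' : N%:R != 0 :> R by rewrite pnatr_eq0 -lt0n.
rewrite /hit_weight /=; case: ltnP => [wk|kw]; last first.
  rewrite big1// mule_ge0// ?lee_fin//.
  by case: ifP => _ //; rewrite lee_fin divr_ge0 ?exprn_ge0.
rewrite (ltnW wk) sumEFin lee_fin -mulr_suml.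
rewrite -(subnSK wk).
rewrite exprS invfM [leRHS]mulrCA mulVKf//.
apply: ler_wpM2r; first by rewrite invr_ge0 exprn_ge0.
rewrite -natr_sum ler_nat.
under eq_bigr do rewrite -sum1_card big_mkcond.
rewrite exchange_big -sum1_card [leqRHS]big_mkcond /=; apply: leq_sum => v _.
case: (pickP (fun b => v \in [set v in cell_hits z rho U k | suffix (b :: w) v]%SET)).
  move=> b bv; rewrite (bigD1 b)//= bv big1 => [|c cb].
    move: bv; rewrite !inE => /andP[-> /suffixP[t ->]].
    by rewrite -cat_rcons suffix_suffix.
  case: ifPn => //; rewrite inE => /andP[_ cv].
  move: bv; rewrite inE => /andP[_ /suffix_cons_inj/(_ cv) bc].
  by rewrite bc eqxx in cb.
by move=> nob; rewrite big1// => b _; rewrite nob.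
Qed.

(** A set no wider than the cells of level [k] meets at most [3 ^ n] of them. *)
Lemma hit_weight_nil z rho (N : nat) U k : 0 < rho -> (0 < N)%N ->
  (diam U <= (cell_side M rho k)%:E)%E ->
  (hit_weight z rho N U k [::] <= (3 ^ n)%:R%:E * (N%:R ^- k)%:E)%E.
Proof.
move=> rho0 N0 /diam_leP HU; rewrite /hit_weight /= subn0 -EFinM lee_fin.
apply: ler_wpM2r; first by rewrite invr_ge0 exprn_ge0.
rewrite ler_nat; apply: leq_trans (card_cells_meeting M_gt0 z rho0 HU).
apply: subset_leq_card; apply/fintype.subsetP => v.
by rewrite !inE => /andP[/asboolP].
Qed.

Lemma hit_weight_hit z rho (N : nat) U w :
  cell z rho w `&` U !=set0 -> (1 <= hit_weight z rho N U (size w) w)%E.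
Proof.
move=> wU; rewrite /hit_weight leqnn subnn expr0 divr1 lee_fin ler1n card_gt0.
apply/set0Pn; exists (in_tuple w); rewrite !inE suffix_refl andbT.
exact/asboolP.
Qed.

(** If the measure vanished, a cover [U] of [E] with tiny total gauge would exist. Each [U i] is
    watched at the level matching its diameter, so the hit weights sum to less than 1 at the root,
    and a good path of weight below 1 has its limit point in [E] but in no [U i]. *)
Lemma mass_distribution z rho s (N : nat) (good : seq digit -> {set digit})
    (E : set 'rV[R]_n) :
  0 < rho -> 0 <= s -> (1 < M)%N -> (1 < N)%N -> M%:R `^ s <= N%:R ->
  (forall w, (N <= #|good w|)%N) ->
  (forall (f : nat -> seq digit) x,
    (forall k, size (f k) = k) ->
    (forall k, exists2 b, b \in good (f k) & f k.+1 = b :: f k) ->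
    (forall k, cell z rho (f k) x) -> E x) ->
  hausdorff_measure s E != 0%E.
Proof.
move=> rho0 s0 M1 N1 MN goodN HE; apply/eqP => /hausdorff_measure_eq0P/(_ rho rho0).
have N0 := ltnW N1.
pose C : R := (M%:R / rho) `^ s; pose D : R := (3 ^ n)%:R.
have C0 : 0 < C by rewrite powR_gt0// divr_gt0// ltr0n.
have D0 : 0 < D by rewrite ltr0n expn_gt0.
(* The gauges and the slacks then contribute at most 1/4 each to the weight at the root. *)
pose eta : R := (4 * D * C)^-1; pose e : R := (4 * D)^-1.
have eta0 : 0 < eta by rewrite invr_gt0 !mulr_gt0.
have e0 : 0 < e by rewrite invr_gt0 !mulr_gt0.
move=> pm0.
have pmfin : hausdorff_premeasure s rho E \is a fin_num by rewrite pm0.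
have [_ [U [EU Urho] <-]] := lb_ereal_inf_adherent eta0 pmfin.
rewrite -/(hausdorff_premeasure s rho E) pm0 add0e => sumU. 
have lev i : exists k, U i !=set0 -> (diam (U i) <= (cell_side M rho k)%:E)%E /\
    (((N%:R ^- k)%:E <= C%:E * hgauge s (U i) + (e / (2 ^ i.+1)%:R)%:E)%E).
  have [U0|] := pselect (U i !=set0); last by exists 0%N.
  have ei0 : 0 < e / (2 ^ i.+1)%:R by rewrite divr_gt0// ltr0n expn_gt0.
  have [k Hk] := gauge_level rho0 s0 M1 N1 MN ei0 U0 (Urho i).
  by exists k.
have [lv Hlv] := choice lev.
(* An empty [U i] has no matching level and gets weight 0. *)
pose phi i w := if `[< U i !=set0 >] then hit_weight z rho N (U i) (lv i) w else 0%E.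
have phi_nil i : (phi i [::] <=
    D%:E * (C%:E * hgauge s (U i) + (e / (2 ^ i.+1)%:R)%:E))%E.
  rewrite /phi; case: asboolP => [/Hlv[Ud Nk]|_].
    apply: le_trans (hit_weight_nil _ rho0 N0 Ud) _.
    by rewrite lee_wpmul2l// lee_fin ltW.
  by rewrite mule_ge0 ?adde_ge0 ?mule_ge0 ?hgauge_ge0 ?lee_fin ?divr_ge0 ?ltW.
have phi_sum : (\sum_(0 <= i <oo) phi i [::] < 1)%E.
  apply: (@le_lt_trans _ _ (D%:E * (C%:E * eta%:E + e%:E))%E).
    apply: (@le_trans _ _ (\sum_(0 <= i <oo)
        (D%:E * (C%:E * hgauge s (U i) + (e / (2 ^ i.+1)%:R)%:E)))%E).
      apply: lee_nneseries => // i _ _; rewrite /phi; case: ifP => // _.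
      exact: hit_weight_ge0.
    rewrite nneseriesZl; last first.
      by move=> i _; rewrite adde_ge0 ?mule_ge0 ?hgauge_ge0 ?lee_fin ?divr_ge0 ?ltW.
    apply: lee_wpmul2l; first by rewrite lee_fin ltW.
    have Ch0 i : (0 <= C%:E * hgauge s (U i))%E.
      by rewrite mule_ge0 ?hgauge_ge0 ?lee_fin ?ltW.
    apply: le_trans (epsilon_trick xpredT Ch0 (ltW e0)) _.
    rewrite leeD2r// nneseriesZl; last by move=> i _; exact: hgauge_ge0.
    by apply: lee_wpmul2l; [rewrite lee_fin ltW|exact: ltW].
  suff : ((D * (C * eta + e))%:E < 1)%E by [].
  rewrite lte_fin /eta /e.
  have -> : D * (C * (4 * D * C)^-1 + (4 * D)^-1) = 2^-1 by field; lra.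
  lra.
have phi_ge0 i w : (0 <= phi i w)%E.
  by rewrite /phi; case: ifP => // _; exact: hit_weight_ge0.
have phiS i w : (\sum_b phi i (b :: w) <= N%:R%:E * phi i w)%E.
  rewrite /phi; case: ifP => _; first exact: hit_weight_sum.
  by rewrite big1 ?mule0.
have [f [f0 fS]] := supermartingale_escape N0 goodN
  (phi := phi) phi_ge0 phiS phi_sum.
have szf k : size (f k) = k.
  by elim: k => [|k IH]; [rewrite f0|case: (fS k) => -[b _ ->] _ /=; rewrite IH].
have path k : exists2 b, b \in good (f k) & f k.+1 = b :: f k by case: (fS k).
have [x Hx] := cell_nested z rho0 (fun k => let: ex_intro2 b _ fk := path k in
  ex_intro (fun b => f k.+1 = b :: f k) b fk).
have [i _ Uix] := EU _ (HE f x szf path Hx).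
have Ui0 : U i !=set0 by exists x.
(* The cell of the path at level [lv i] contains [x], hence hits [U i], and this single term already
   makes the weight at least 1. *)
have [_] := fS (lv i); apply/negP; rewrite -leNgt.
apply: (@le_trans _ _ (phi i (f (lv i)))); last first.
  rewrite (@nneseriesD1 _ _ i xpredT)//= leeDl//.
  by apply: nneseries_ge0 => k _ _; exact: phi_ge0.
rewrite /phi ifT ?asboolT//.
have {1}-> : lv i = size (f (lv i)) by rewrite szf.
by apply: hit_weight_hit; exists x.
Qed.

End NestedCells.

(** * The simplex lemma *)

(** A maximal free family in [S] has fewer than [m] rows, since no square one is invertible, and it
    spans [S]; its cokernel provides [u]. *)
Lemma common_kernel (F : fieldType) (m : nat) (S : set 'rV[F]_m) :
  (forall A : 'M[F]_m, (forall i, S (row i A)) -> \det A = 0) ->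
  exists2 u : 'cV[F]_m, u != 0 & forall v, S v -> v *m u = 0.
Proof.
move=> detS.
pose P k := `[< exists A : 'M[F]_(k, m), row_free A /\ forall i, S (row i A) >].
have P0 : exists k, P k.
  exists 0%N; apply/asboolP; exists 0; split; last by case.
  by rewrite /row_free mxrank0.
have Pm k : P k -> (k <= m)%N.
  by move=> /asboolP[A [/eqP fA _]]; rewrite -fA rank_leq_col.
case: (ex_maxnP P0 Pm) => k /asboolP[A [freeA SA]] maxk.
have km : (k < m)%N.
  rewrite ltn_neqAle -(eqP freeA) rank_leq_col andbT (eqP freeA).
  apply/eqP => km; move: A freeA SA; rewrite km => A freeA SA.
  by move: freeA; rewrite row_free_unit unitmxE detS// unitr0.
have vA v : S v -> (v <= A)%MS.
  move=> Sv; apply/negPn/negP => vA.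
  suff /maxk : P (k + 1)%N by rewrite addn1 ltnn.
  apply/asboolP; exists (col_mx A v); split.
    rewrite /row_free eqn_leq rank_leq_row -addsmxE addn1 -{1}(eqP freeA).
    by apply: rank_ltmx; rewrite ltmxE addsmxSl addsmx_sub submx_refl.
  by move=> i; case: (split_ordP i) => j ->; rewrite ?rowKu ?rowKd// ord1 row_id.
have /rowV0Pn[w wK w0] : (cokermx A)^T != 0.
  by rewrite -mxrank_eq0 mxrank_tr mxrank_coker (eqP freeA) -lt0n subn_gt0.
exists w^T; first by rewrite -(inj_eq trmx_inj) trmxK trmx0.
move=> v /vA /submxP[B ->]; have /submxP[C ->] := wK.
by rewrite trmx_mul trmxK -mulmxA (mulmxA A) mulmx_coker mul0mx mulmx0.
Qed.

(** Each product in the Leibniz expansion has exactly one factor from column 0 and [n] factors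
    bounded by [e]. *)
Lemma det_le (R : realDomainType) (n : nat) (A : 'M[R]_n.+1) (e : R) :
  0 <= e -> (forall i, `|A i 0| <= 1) -> (forall i j, `|A i (lift 0 j)| <= e) ->
  `|\det A| <= (n.+1)`!%:R * e ^+ n.
Proof.
move=> e0 A0 Ae; apply: le_trans (ler_norm_sum _ _ _) _.
rewrite -card_Sn -sum1_card natr_sum mulr_suml; apply: ler_sum => s _.
rewrite mul1r normrM normrX normrN1 expr1n mul1r normr_prod.
pose B (j : 'I_n.+1) : R := if j == 0 then 1 else e.
apply: (@le_trans _ _ (\prod_i B (s i))).
  apply: ler_prod => i _; rewrite normr_ge0 /B /=.
  by case: ifPn => [/eqP ->//|]; rewrite eq_sym => /unlift_some[j -> _].
rewrite (_ : \prod_i _ = \prod_i B i); last first.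
  by rewrite [RHS](reindex_inj (@perm_inj _ s)).
rewrite big_ord_recl {1}/B eqxx mul1r.
under eq_bigr => i _ do rewrite /B eq_sym (negPf (neq_lift _ _)).
by rewrite prodr_const card_ord.
Qed.

Definition ratpoint (R : realType) n (q : nat) (p : 'rV[int]_n) : 'rV[R]_n :=
  q%:R^-1 *: map_mx (fun z : int => z%:~R) p.

(** Homogeneous coordinates: a linear form vanishing on this vector is an affine equation satisfied
    by [p / q]. *)
Definition homog (R : pzRingType) n (q : nat) (p : 'rV[int]_n) : 'rV[R]_(1 + n) :=
  row_mx q%:R%:M (map_mx (fun z : int => z%:~R) p).

(* The determinant is an integer, and multilinearity bounds it by
   [\prod_i q i * (n+1)! * e^n < 1]. *)
Lemma simplex (R : realType) n (q : 'I_(1 + n) -> nat) (p : 'I_(1 + n) -> 'rV[int]_n)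
    (z : 'rV[R]_n) (e : R) :
  0 <= e -> (forall i, (0 < q i)%N) ->
  (forall i j, `|ratpoint R (q i) (p i) 0 j - z 0 j| <= e) ->
  \prod_i (q i)%:R * ((n.+1)`!%:R * e ^+ n) < 1 ->
  \det (\matrix_i homog R (q i) (p i)) = 0.
Proof.
move=> e0 q0 pe small.
set A := \matrix_i _.
pose A2 := \matrix_i row_mx (1 : 'M[R]_1) (ratpoint R (q i) (p i) - z).
(* The denominators are pulled out of the rows, and a unipotent factor translates by [z]; neither
   shear nor translation changes the determinant. *)
have AE : A = diag_mx (\row_i (q i)%:R) *m (A2 *m block_mx 1 z 0 1%:M).
  apply/row_matrixP => i; rewrite row_mul row_diag_mx -scalemxAl -rowE row_mul !rowK mul_row_block.
  rewrite !mulmx1 mul1mx mulmx0 addr0 addrC subrK mxE scale_row_mx; congr row_mx.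
    by rewrite scalemx1.
  by rewrite /ratpoint scalerA divff ?scale1r// pnatr_eq0 -lt0n.
have detA : \det A = \prod_i (q i)%:R * \det A2.
  rewrite AE !det_mulmx det_diag det_ublock !det1 !mulr1; congr (_ * _).
  by apply: eq_bigr => i _; rewrite mxE.
pose Z : 'M[int]_(1 + n) := \matrix_i row_mx (q i)%:Z%:M (p i).
have detZ : \det A = (\det Z)%:~R.
  rewrite -det_map_mx; congr (\det _); apply/row_matrixP => i.
  rewrite -map_row !rowK map_row_mx; congr row_mx.
  by apply/matrixP => a b; rewrite !mxE !ord1 /= !mulr1n.
have : `|\det A| < 1.
  apply: le_lt_trans small; rewrite detA normrM ger0_norm ?prodr_ge0//.
  apply: ler_wpM2l; first exact: prodr_ge0.
  apply: det_le => // [i|i j].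
    have -> : A2 i 0 = A2 i (lshift n 0) by congr (A2 i _); exact: val_inj.
    by rewrite /A2 mxE row_mxEl mxE eqxx normr1.
  have -> : A2 i (lift 0 j) = A2 i (rshift 1 j) by congr (A2 i _); exact: val_inj.
  by rewrite /A2 mxE row_mxEr mxE [X in _ + X]mxE; exact: pe.
rewrite detZ -intr_norm -[1]/(1%:~R) ltr_int => dZ.
suff -> : \det Z = 0 by [].
by move: dZ; case: (\det Z) => [[|?]|?].
Qed.

(** By [simplex] these rationals lie on one affine hyperplane. With [j] the largest coordinate of
    its normal [u'], the equation bounds a displacement along [j] by those in the other
    directions. *)
Lemma rational_hyperplane (R : realType) n (z : 'rV[R]_n) (e T : R) : (0 < n)%N ->
  0 <= e -> T ^+ n.+1 * ((n.+1)`!%:R * e ^+ n) < 1 ->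
  exists j : 'I_n, forall q q' (p p' : 'rV[int]_n),
    (0 < q)%N -> (0 < q')%N -> q%:R <= T -> q'%:R <= T ->
    (forall i, `|ratpoint R q p 0 i - z 0 i| <= e) ->
    (forall i, `|ratpoint R q' p' 0 i - z 0 i| <= e) ->
    `|ratpoint R q p 0 j - ratpoint R q' p' 0 j| <=
      \sum_(i | i != j) `|ratpoint R q p 0 i - ratpoint R q' p' 0 i|.
Proof.
move=> n0 e0 small.
pose S0 q (p : 'rV[int]_n) := [/\ (0 < q)%N, q%:R <= T &
  forall i, `|ratpoint R q p 0 i - z 0 i| <= e].
pose S : set 'rV[R]_(1 + n) := [set v | exists q p, S0 q p /\ v = homog R q p].
have [u u0 Su] : exists2 u : 'cV[R]_(1 + n), u != 0 & forall v, S v -> v *m u = 0.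
  apply: common_kernel => A SA.
  have [q Hq] := choice SA; have [p Hp] := choice Hq.
  have -> : A = \matrix_i homog R (q i) (p i).
    by apply/row_matrixP => i; rewrite rowK; case: (Hp i).
  have T0 : 0 <= T by apply: le_trans (_ : (q 0)%:R <= T); case: (Hp 0) => -[].
  apply: (@simplex _ _ _ _ z e) => // [i|i|]; try by case: (Hp i) => -[].
  apply: le_lt_trans small; apply: ler_wpM2r.
    by rewrite mulr_ge0 ?exprn_ge0.
  rewrite -[X in _ <= _ ^+ X](card_ord n.+1) -prodr_const; apply: ler_prod => i _.
  by rewrite ler0n; case: (Hp i) => -[].
pose u' (i : 'I_n) := u (rshift 1 i) 0.
have [i0 _] : exists i0 : 'I_n, true by exists (Ordinal n0).
pose j := [arg max_(i > i0) `|u' i|]%O.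
have jmax i : `|u' i| <= `|u' j|.
  by rewrite /j; case: Order.TotalTheory.arg_maxP => // k _; exact.
exists j => q q' p p' q0 q0' qT q'T pe p'e.
have lin qq pp : S0 qq pp -> u 0 0 + \sum_i ratpoint R qq pp 0 i * u' i = 0.
  move=> Spp; have qq0 : qq%:R != 0 :> R by case: Spp => ? _ _; rewrite pnatr_eq0 -lt0n.
  have /matrixP/(_ 0 0) : homog R qq pp *m u = 0 by apply: Su; exists qq, pp.
  rewrite !mxE big_split_ord big_ord1 /homog /= row_mxEl mxE eqxx mulr1n => H.
  apply: (mulfI qq0); rewrite mulr0 -[RHS]H mulrDr; congr (_ * u _ _ + _).
    exact: val_inj.
  rewrite mulr_sumr; apply: eq_bigr => i _.
  by rewrite row_mxEr !mxE mulrA mulrA divff// mul1r.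
have h : \sum_i (ratpoint R q p 0 i - ratpoint R q' p' 0 i) * u' i = 0.
  under eq_bigr do rewrite mulrBl.
  rewrite sumrB; apply/eqP; rewrite subr_eq0; apply/eqP.
  by apply: (addrI (u 0 0)); rewrite !lin.
(* If [u'] vanished, the equation at [p / q] would force [u 0 0 = 0] too. *)
have uj0 : 0 < `|u' j|.
  rewrite lt_neqAle normr_ge0 andbT eq_sym; apply: contra_neqN u0 => /eqP uj0.
  have u'0 i : u' i = 0.
    by apply/eqP; rewrite -normr_eq0 eq_le normr_ge0 -uj0 jmax.
  apply/matrixP => a b; rewrite !ord1 mxE.
  have u00 : u 0 0 = 0.
    have := @lin q p; rewrite big1 ?addr0; [by apply|by move=> i _; rewrite u'0 mulr0].
  case: (split_ordP a) => c ->; last exact: u'0.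
  by rewrite ord1 -[RHS]u00; congr (u _ _); exact: val_inj.
move: h; rewrite (bigD1 j)//= => /eqP; rewrite addr_eq0 => /eqP h.
rewrite -(ler_pM2r uj0) -normrM h normrN mulr_suml.
apply: le_trans (ler_norm_sum _ _ _) _; apply: ler_sum => i _.
by rewrite normrM ler_wpM2l.
Qed.

(** * The lower bound *)

Lemma powR_bracket (R : realType) (M : nat) (a : R) : (1 < M)%N -> 1 <= a ->
  exists k, M%:R ^+ k <= a < M%:R ^+ k.+1.
Proof.
move=> M1 a1; pose P k := M%:R ^+ k <= a.
have P0 : exists k, P k by exists 0%N; rewrite /P expr0.
have Pb k : P k -> (k <= Num.truncn a)%N.
  rewrite /P => Pk; rewrite -ltnS -(ltr_nat R).
  apply: le_lt_trans (truncnS_gt a); apply: le_trans Pk.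
  by rewrite -natrX ler_nat ltnW// ltn_expl.
case: (ex_maxnP P0 Pb) => k Pk maxk; exists k; apply/andP; split=> //.
by rewrite ltNge; apply/negP => /maxk; rewrite ltnn.
Qed.

Section LowerBound.
Context {R : realType} (n' M : nat) (c : R).
Local Notation n := n'.+1.
Local Notation digit := {ffun 'I_n -> 'I_M}.
Implicit Types (w : seq digit) (b : digit).

(* [K] is large enough for the simplex lemma in a cube of side [4 * rho * M^-k], with
   [height q < M^(k+1)]; then the neighbourhoods to avoid have radius at most [K]
   subcube sides, and [m] bounds the spread of their subcubes across the hyperplane. *)
Let K : nat := (4 * n.+1`!)%N.
Let rho : R := (K * M)%:R^-1.
Let m : nat := (n + 2 * n.+1 * K)%N.

Context (M_gt1 : (1 < M)%N).
Context (c_gt0 : 0 < c).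
Context (cM2 : c * M%:R ^+ 2 <= 1).
Context (cKM : c * (K * M)%:R <= 1).

Let M_gt0 : (0 < M)%N. Proof. exact: ltnW. Qed.
Let K_gt0 : (0 < K)%N. Proof. by rewrite muln_gt0 fact_gt0. Qed.
Let MR : 0 < M%:R :> R. Proof. by rewrite ltr0n. Qed.
Let KR : 0 < K%:R :> R. Proof. by rewrite ltr0n. Qed.
Let rho_gt0 : 0 < rho. Proof. by rewrite invr_gt0 ltr0n muln_gt0 K_gt0. Qed.

Definition height (q : nat) : R := q%:R `^ (1 + n%:R^-1).

(** The bracket on [height q] assigns each rational to a single level, so one step of a path
    suffices to stay away from it. *)
Definition removed w b := exists q (p : 'rV[int]_n) (y : 'rV[R]_n),
  [/\ (0 < q)%N, M%:R ^+ size w <= height q < M%:R ^+ (size w).+1,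
      cell 0 rho (b :: w) y & `|y - ratpoint R q p| < c / height q].

Lemma height_lt q k : height q < M%:R ^+ k -> q%:R <= (M%:R ^+ k) `^ (n%:R / n.+1%:R) :> R.
Proof.
move=> /ltW H; have n0 : n%:R != 0 :> R by rewrite pnatr_eq0.
have n1 : n.+1%:R != 0 :> R by rewrite pnatr_eq0.
apply: (@le_trans _ _ (height q `^ (n%:R / n.+1%:R))); last first.
  by rewrite ge0_ler_powR ?nnegrE ?powR_ge0 ?exprn_ge0 ?divr_ge0.
rewrite -powRrM (_ : _ * _ = 1) ?powRr1//; move: n1; rewrite -[n.+1%:R]natr1.
by move: (n%:R : R) n0 => a a0 a1; field; rewrite a0 a1.
Qed.

(** The rationals causing removals lie on a hyperplane with dominant direction [j]. If two removed
    children agree off [j], their rationals differ by at most [l + 2 * v] there, hence by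
    [n * (l + 2 * v)] along [j]; so the points [y], [y'] differ along [j] by at most
    [n * (l + 2 * v) + 2 * v <= m * l]. *)
Lemma removed_direction w : exists j, forall b b', removed w b -> removed w b' ->
  (forall i, i != j -> b i = b' i) -> (b j <= b' j + m.+1)%N.
Proof.
set k := size w.
pose side := cell_side M rho k.
have side0 : 0 < side by exact: cell_side_gt0.
pose T : R := (M%:R ^+ k.+1) `^ (n%:R / n.+1%:R).
have TE : T ^+ n.+1 = (M%:R ^+ k.+1) ^+ n.
  rewrite /T -powR_mulrn ?powR_ge0// -powRrM divfK ?pnatr_eq0//.
  by rewrite powR_mulrn ?exprn_ge0.
(* The choice of [rho] and [K] gives [M ^ k.+1 * (2 * side) = 2 / K], the inverse of [2 * n.+1!]. *)
have small : T ^+ n.+1 * ((n.+1)`!%:R * (2 * side) ^+ n) < 1.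
  rewrite TE mulrCA -exprMn.
  have -> : M%:R ^+ k.+1 * (2 * side) = (2 * (n.+1)`!%:R)^-1.
    rewrite /side /cell_side /rho /K !natrM exprS; field.
    by rewrite ?pnatr_eq0 ?expf_neq0 ?(gt_eqF MR)//= -?lt0n ?fact_gt0 ?gt_eqF ?ltr0n ?fact_gt0.
  rewrite -ltr_pdivlMl ?ltr0n ?fact_gt0// mulr1.
  have F1 : 1 <= (n.+1)`!%:R :> R by rewrite ler1n fact_gt0.
  apply: (@le_lt_trans _ _ (2 * (n.+1)`!%:R)^-1).
    have F2 : 0 < 2 * n.+1`!%:R :> R by lra.
    by rewrite ler_iXnr// ?invr_ge0 ?invf_le1// ?ltW//; lra.
  by rewrite ltf_pV2 ?posrE; lra.
have [j Hj] := @rational_hyperplane R n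
  (\row_i ((cell_index w i)%:R * side)) (2 * side) T isT (mulr_ge0 (ler0n _ _) (ltW side0)) small.
exists j => b b' [q [p [y [q0 /andP[hq1 hq2] yb yq]]]]
  [q' [p' [y' [q'0 /andP[h'q1 h'q2] y'b y'q]]]] bb'.
(* Bounds [c / height q] for all rationals of this level. [v <= side] keeps them in the cube of the
   simplex lemma; [v <= K * l] measures the neighbourhood in subcube sides. *)
pose v : R := c / M%:R ^+ k.
pose l := cell_side M rho k.+1.
have l0 : 0 < l by exact: cell_side_gt0.
have v_side : v <= side.
  rewrite /v /side /cell_side ler_pM2r ?invr_gt0 ?exprn_gt0//.
  by rewrite /rho -[leRHS]mul1r ler_pdivlMr// ltr0n muln_gt0 K_gt0.
have v_l : v <= K%:R * l.
  rewrite /v /l /cell_side /rho ler_pdivrMr ?exprn_gt0//.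
  have -> : K%:R * ((K * M)%:R^-1 / M%:R ^+ k.+1) * M%:R ^+ k = (M%:R ^+ 2)^-1 :> R.
    rewrite natrM exprS expr2; field.
    by rewrite (lt0r_neq0 MR) (lt0r_neq0 KR) expf_neq0 ?(lt0r_neq0 MR).
  by rewrite -[leRHS]mul1r ler_pdivlMr// exprn_gt0.
have close qq (pp : 'rV[int]_n) yy : M%:R ^+ k <= height qq ->
    `|yy - ratpoint R qq pp| < c / height qq ->
    forall i, `|yy 0 i - ratpoint R qq pp 0 i| <= v.
  move=> hqq yq' i.
  have v0 : 0 <= v by rewrite divr_ge0 ?ltW ?exprn_gt0.
  have /rV_norm_leP -/(_ v0 i) : `|yy - ratpoint R qq pp| <= v.
    apply/ltW/(lt_le_trans yq'); rewrite ler_pM2l//.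
    by rewrite lef_pV2// posrE ?exprn_gt0// (lt_le_trans _ hqq) ?exprn_gt0.
  by rewrite !mxE.
have corner qq (pp : 'rV[int]_n) bb yy : cell 0 rho (bb :: w) yy ->
    (forall i, `|yy 0 i - ratpoint R qq pp 0 i| <= v) ->
    forall i, `|ratpoint R qq pp 0 i -
      (\row_i ((cell_index w i)%:R * side) : 'rV[R]_n) 0 i| <= 2 * side.
  move=> /(cell_cons_sub M_gt0 rho_gt0) cw /[swap] i /(_ i).
  have := cw i; rewrite !mxE -/side subr0 -natr1 => /andP[lo hi].
  rewrite !ler_norml => /andP[? ?]; apply/andP; split; lra.
have yv := close _ _ _ hq1 yq; have y'v := close _ _ _ h'q1 y'q.
have := Hj q q' p p' q0 q'0 (height_lt hq2) (height_lt h'q2)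
  (corner _ _ _ _ yb yv) (corner _ _ _ _ y'b y'v).
set S := \sum_(i | _) _ => ratj.
have Sle : S <= n%:R * (l + 2 * v).
  apply: (@le_trans _ _ (\sum_(i < n) (l + 2 * v))); last first.
    by rewrite sumr_const card_ord -[leLHS]mulr_natl.
  have lv0 : 0 <= l + 2 * v by have := normr_ge0 (y 0 j - ratpoint R q p 0 j);
    have := yv j; lra.
  rewrite [leRHS](bigID (fun i => i != j))/= -[leLHS]addr0 lerD ?sumr_ge0//.
  apply: ler_sum => i ij.
  have yi : `|y 0 i - y' 0 i| <= l.
    have := yb i; have := y'b i; rewrite /= (bb' _ ij) -/k -/l -natr1.
    by rewrite ler_norml => /andP[? ?] /andP[? ?]; apply/andP; split; lra.
  move: (yv i) (y'v i) yi; rewrite !ler_norml.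
  by move=> /andP[? ?] /andP[? ?] /andP[? ?]; apply/andP; split; lra.
have yj : y 0 j - y' 0 j <= m%:R * l.
  have : y 0 j - y' 0 j <= S + 2 * v.
    move: (yv j) (y'v j) ratj; rewrite !ler_norml.
    by move=> /andP[? ?] /andP[? ?] /andP[? ?]; lra.
  move/le_trans; apply.
  have -> : m%:R = n%:R + 2 * (n%:R + 1) * K%:R :> R.
    by rewrite /m natrD natrM (natrM _ 2) natr1.
  apply: (@le_trans _ _ (n%:R * (l + 2 * v) + 2 * v)); first lra.
  have n0 : 0 <= 2 * n%:R + 2 :> R by rewrite addr_ge0 ?mulr_ge0.
  have := ler_wpM2l n0 v_l; lra.
have := cell_index_dist M_gt0 rho_gt0 _ yb y'b yj.
move=> /(_ erefl) /=.
by rewrite -addnA leq_add2l.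
Qed.

(* Two removed digits that agree off direction [j] differ by at most [m.+1] there, so
   a removed digit is determined by its other entries and its residue mod [m.+2]. *)
Lemma card_removed w : (#|[set b | `[< removed w b >]]%SET| <= M ^ n' * m.+2)%N.
Proof.
have [j Hj] := removed_direction w.
pose h b : {ffun 'I_n' -> 'I_M} * 'I_m.+2 :=
  ([ffun i => b (lift j i)], inord (b j %% m.+2)).
rewrite -[X in (_ <= X)%N](_ : #|{: {ffun 'I_n' -> 'I_M} * 'I_m.+2}| = _); last first.
  by rewrite card_prod card_ffun !card_ord.
rewrite -(@card_in_imset _ _ h) ?max_card// => b b'.
rewrite !inE => rb rb' [hl hj].
have off i : i != j -> b i = b' i.
  rewrite eq_sym => /unlift_some[i' -> _].
  by have /ffunP/(_ i') := hl; rewrite !ffunE.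
have Emod : (b j = b' j %[mod m.+2])%N.
  by have := congr1 val hj; rewrite /= !inordK ?ltn_mod.
have le1 := Hj _ _ rb rb' off.
have le2 := Hj _ _ rb' rb (fun i ij => esym (off i ij)).
apply/ffunP => i; have [->|/off//] := eqVneq i j.
apply: val_inj => /=; move: (nat_of_ord (b j)) (nat_of_ord (b' j)) Emod le1 le2.
move: (m) => a; clear; move=> x y Emod le1 le2.
wlog xy : x y Emod le1 le2 / (x <= y)%N.
  by case: (leqP x y) => [xy H|/ltnW xy H]; [|apply/esym]; apply: H.
have /eqP := esym Emod; rewrite eqn_mod_dvd// => /dvdn_leq.
by case: (posnP (y - x)) => [|yx /(_ isT)]; lia.
Qed.

Definition kept w := [set b | ~~ `[< removed w b >]]%SET.

Lemma card_kept w : (M ^ n' * (M - m.+2) <= #|kept w|)%N.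
Proof.
have -> : kept w = (~: [set b | `[< removed w b >]])%SET.
  by apply/setP => b; rewrite !inE.
rewrite cardsCs finset.setCK card_ffun !card_ord mulnBr -expnSr.
exact: leq_sub2l (card_removed w).
Qed.

(** Were [x] too close to [p / q], then at the level bracketing [height q] the point [x] itself
    would witness that the child chosen there is removed. *)
Lemma kept_path_Bad (f : nat -> seq digit) x :
  (forall k, size (f k) = k) ->
  (forall k, exists2 b, b \in kept (f k) & f k.+1 = b :: f k) ->
  (forall k, cell 0 rho (f k) x) -> Bad c x.
Proof.
move=> szf fS Hx q p q0; rewrite -/(height q) -/(ratpoint R q p).
rewrite leNgt; apply/negP => near.
have h1 : 1 <= height q.
  apply: (@le_trans _ _ (1 `^ (1 + n%:R^-1))); first by rewrite powR1.
  by apply: ge0_ler_powR; rewrite ?nnegrE ?ler1n// addr_ge0 ?invr_ge0.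
have [k hk] := powR_bracket M_gt1 h1.
have [b + fk] := fS k; rewrite inE => /asboolP; apply.
by exists q, p, x; split=> //; rewrite ?szf// -fk.
Qed.

Lemma hausdorff_measure_Bad_neq0 s : 0 <= s -> (2 * m.+2 <= M)%N ->
  M%:R `^ s <= (M ^ n' * (M - m.+2))%:R :> R ->
  hausdorff_measure s (@Bad R n c) != 0%E.
Proof.
move=> s0 mM Ms.
apply: (mass_distribution M_gt0 rho_gt0 s0 M_gt1 _ Ms card_kept kept_path_Bad).
(* Still to check that more than one child is kept: [M - m.+2 >= m.+2 >= 2]. *)
have : (0 < M ^ n')%N by rewrite expn_gt0 M_gt0.
move: (M ^ n')%N => a a0; nia.
Qed.

End LowerBound.
Arguments height R n' q : clear implicits.

(** * The upper bound *)

(** Pigeonhole: among the multiples [k * x] with [0 <= k <= Q ^ n], two have fractional parts in the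
    same of the [Q ^ n] boxes of side [1 / Q]; [q] is the difference of their indices. *)
Lemma dirichlet (R : realType) n (x : 'rV[R]_n) (Q : nat) : (0 < Q)%N ->
  exists q (p : 'rV[int]_n), [/\ (0 < q)%N, (q <= Q ^ n)%N &
    forall j, `|q%:R * x 0 j - (p 0 j)%:~R| <= Q%:R^-1].
Proof.
move=> Q0; have QR : 0 < Q%:R :> R by rewrite ltr0n.
pose fr (k : nat) j : R := k%:R * x 0 j - (Num.floor (k%:R * x 0 j))%:~R.
have box (k : nat) : exists f : {ffun 'I_n -> 'I_Q},
    forall j, (f j)%:R <= fr k j * Q%:R <= (f j).+1%:R.
  have H j : exists i : 'I_Q, i%:R <= fr k j * Q%:R <= i.+1%:R.
    apply: unit_subdivision => //.
    have /andP[lo hi] := floor_itv (k%:R * x 0 j).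
    have fr0 : 0 <= fr k j by rewrite subr_ge0.
    have fr1 : fr k j <= 1 by move: hi; rewrite /fr intrD; lra.
    by rewrite mulr_ge0 ?(ltW QR)//= -[leRHS]mul1r ler_wpM2r// ltW.
  have [f Hf] := choice H; exists (finfun f) => j; rewrite ffunE; exact: Hf.
have [f Hf] := choice box.
have : ~~ injectiveb (fun k : 'I_(Q ^ n).+1 => f k).
  apply/negP => /injectiveP /leq_card.
  by rewrite card_ffun !card_ord ltnn.
case/injectivePn => k1 [k2 k12 f12].
wlog lt12 : k1 k2 k12 f12 / (k1 < k2)%N.
  move=> H; case: (ltngtP k1 k2) => [/H|/H|/val_inj E]; first exact.
    by apply; [rewrite eq_sym|].
  by rewrite E eqxx in k12.
exists (k2 - k1)%N, (\row_j (Num.floor (k2%:R * x 0 j) - Num.floor (k1%:R * x 0 j))).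
split; [by rewrite subn_gt0|by rewrite leq_subLR (leq_trans _ (leq_addl _ _))// -ltnS|move=> j].
rewrite mxE natrB ?(ltnW lt12)// intrD intrN.
have := Hf k1 j; have := Hf k2 j; rewrite f12 /fr -natr1.
move=> /andP[? ?] /andP[? ?].
rewrite -[leRHS]mul1r ler_pdivlMr// -(ger0_norm (ltW QR)) -normrM ler_norml.
by apply/andP; split; lra.
Qed.

Lemma half_bounds (m : nat) : (2 * m./2 <= m <= (2 * m./2).+1)%N.
Proof. lia. Qed.

(** The central subinterval has margins of at least [7 * r / 16] and [3 * r / 8] inside the large
    one, both above [r / 4]. *)
Lemma central_bounds (R : realFieldType) (a g l r x y : R) :
  r - l <= 2 * g -> 2 * g <= r -> 8 * l <= r ->
  `|x - y| <= r / 4 -> a + g <= x <= a + (g + l) -> a <= y <= a + r.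
Proof.
rewrite ler_norml => ? ? ? /andP[? ?] /andP[? ?].
by apply/andP; split; lra.
Qed.

Section UpperBound.
Context {R : realType} (n' : nat) (c : R).
Local Notation n := n'.+1.
Context (c_gt0 : 0 < c).

(** Dirichlet's error is at most [1 / (q * Q)], so badness of [x] forces [q ^ (1 / n) >= c * Q].
    This lower bound on [q] improves the error; [q <= Q ^ n] bounds the height. *)
Lemma Bad_near_rational (x : 'rV[R]_n) (Q : nat) : (0 < Q)%N -> Bad c x ->
  exists q (p : 'rV[int]_n), [/\ (0 < q)%N, height R n' q <= Q%:R ^+ n.+1 &
    forall j, `|x 0 j - ratpoint R q p 0 j| <= (c ^+ n * Q%:R ^+ n.+1)^-1].
Proof.
move=> Q0 Bx; have QR : 0 < Q%:R :> R by rewrite ltr0n.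
have [q [p [q0 qQ Hp]]] := dirichlet x Q0.
have qR : 0 < q%:R :> R by rewrite ltr0n.
have heightE : height R n' q = q%:R * q%:R `^ n%:R^-1.
  rewrite /height powRD ?powRr1 ?ltW//.
  by apply/implyP => _; rewrite gt_eqF.
have rootn (a : R) : 0 <= a -> (a `^ n%:R^-1) ^+ n = a.
  by move=> a0; rewrite -powR_mulrn ?powR_ge0// -powRrM mulVf ?pnatr_eq0// powRr1.
have xp j : `|x 0 j - ratpoint R q p 0 j| <= (q%:R * Q%:R)^-1.
  rewrite invfM -ler_pdivrMl ?invr_gt0// invrK -{1}(ger0_norm (ltW qR)) -normrM.
  by rewrite mulrBr !mxE mulVKf ?gt_eqF// mulrC [leRHS]mulrC.
have qlow : c * Q%:R <= q%:R `^ n%:R^-1.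
  have xpn : `|x - ratpoint R q p| <= (q%:R * Q%:R)^-1.
    apply/rV_norm_leP => [|j]; first by rewrite invr_ge0 mulr_ge0.
    by rewrite mxE [X in _ + X]mxE.
  have := le_trans (Bx q p q0) xpn; rewrite -/(height R n' q) heightE.
  rewrite ler_pdivrMr ?mulr_gt0 ?powR_gt0//.
  set a := _ `^ _; have -> : (q%:R * Q%:R)^-1 * (q%:R * a) = a / Q%:R.
    by field; rewrite !gt_eqF.
  by rewrite ler_pdivlMr.
exists q, p; split=> // [|j].
  rewrite heightE -natrX.
  apply: (@le_trans _ _ ((Q ^ n)%:R * Q%:R)); last by rewrite -natrM ler_nat -expnSr.
  apply: ler_pM; rewrite ?ler_nat ?powR_ge0//.
  apply: (@le_trans _ _ ((Q%:R ^+ n) `^ n%:R^-1)).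
    by apply: ge0_ler_powR; rewrite ?nnegrE ?invr_ge0 ?exprn_ge0// -natrX ler_nat.
  by rewrite -powR_mulrn// -powRrM mulfV ?pnatr_eq0// powRr1.
apply: le_trans (xp j) _.
rewrite lef_pV2 ?posrE ?(mulr_gt0 (exprn_gt0 n c_gt0)) ?exprn_gt0 ?mulr_gt0//.
rewrite [Q%:R ^+ _]exprSr mulrA -exprMn ler_pM2r// -[leRHS]rootn//.
by rewrite lerXn2r// nnegrE ?powR_ge0// mulr_ge0 ?ltW.
Qed.

(** Take the least [Q] satisfying the lower bound: if [Q >= 2], then [Q.-1] fails it and
    [Q <= 2 * Q.-1]. *)
Lemma root_bracket (m : nat) (X : R) : 1 <= X ->
  exists2 Q : nat, (0 < Q)%N & X <= Q%:R ^+ m.+1 <= 2 ^+ m.+1 * X.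
Proof.
move=> X1; pose P (Q : nat) := X <= Q%:R ^+ m.+1.
have exP : exists Q, P Q.
  exists (Num.truncn X).+1; rewrite /P; apply: (le_trans (ltW (truncnS_gt X))).
  by rewrite -natrX ler_nat -[leqLHS]expn1 leq_pexp2l.
case: (ex_minnP exP) => Q PQ minQ.
have Q0 : (0 < Q)%N.
  by rewrite lt0n; apply/eqP => Q0; move: PQ; rewrite /P Q0 expr0n /=; lra.
exists Q => //; apply/andP; split=> //.
have [Q1|Q2] := leqP Q 1.
  have -> : Q = 1%N by apply/eqP; rewrite eqn_leq Q1.
  rewrite expr1n -[leLHS]mulr1; apply: ler_pM => //.
  by rewrite exprn_ege1// ler1n.
have : ~~ P Q.-1 by apply/negP => /minQ; lia.
rewrite /P -ltNge => QX.
apply: (@le_trans _ _ (2 ^+ m.+1 * Q.-1%:R ^+ m.+1)); last first.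
  by rewrite ler_pM2l ?exprn_gt0// ltW.
rewrite -exprMn -natrM lerXn2r ?nnegrE// ler_nat; lia.
Qed.

Context (M : nat).
Local Notation digit := {ffun 'I_n -> 'I_M}.
Context (c_le1 : c <= 1).
Context (M_large : 2 ^+ n.+3 < M%:R * c ^+ n.+1).

Let M8 : (8 <= M)%N.
Proof.
rewrite -(ler_nat R); apply/ltW.
have M0 : 0 < M%:R * c ^+ n.+1 by apply: lt_trans M_large; rewrite exprn_gt0.
apply: (@le_lt_trans _ _ (2 ^+ n.+3)).
  by rewrite -natrX ler_nat -[leqLHS]/(2 ^ 3)%N leq_exp2l.
apply: (lt_le_trans M_large); rewrite -[leRHS]mulr1.
by apply: ler_wpM2l => //; rewrite exprn_ile1// ltW.
Qed.

Let M_gt0 : (0 < M)%N. Proof. exact: leq_trans M8. Qed.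

(* Dirichlet's theorem at a point of [Bad c] in the central subcell gives a rational
   well inside the cell; the subcell containing that rational is free of [Bad c]. *)
Lemma free_child (z : 'rV[R]_n) (w : seq digit) :
  exists b, @Bad R n c `&` cell z 1 (b :: w) = set0.
Proof.
have mid : (M./2 < M)%N by rewrite -divn2 ltn_Pdiv.
pose b0 : digit := [ffun=> Ordinal mid].
have [|/eqP/set0P[x [Bx xb0]]] := pselect (@Bad R n c `&` cell z 1 (b0 :: w) = set0).
  by exists b0.
set k := size w.
pose r := cell_side M (1 : R) k; pose l := cell_side M (1 : R) k.+1.
have r0 : 0 < r by exact: cell_side_gt0.
have l0 : 0 < l by exact: cell_side_gt0.
have rl : r = M%:R * l by exact: cell_sideS.
have MR : 0 < M%:R :> R by rewrite ltr0n.
have r1 : r <= 1.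
  by rewrite /r /cell_side div1r invf_le1 ?exprn_gt0// exprn_ege1// ler1n.
have rE : cell_side M 1 k = r by [].
have lE : cell_side M 1 k.+1 = l by [].
clearbody r l.
have cn0 : 0 < c ^+ n by rewrite exprn_gt0.
have cn1 : c ^+ n <= 1 by rewrite exprn_ile1// ltW.
(* With [Q ^ n.+1] at least this value, the rational is within [r / 4] of [x]. *)
have X1 : 1 <= 4 / (c ^+ n * r).
  rewrite ler_pdivlMr ?mulr_gt0// mul1r.
  apply: (@le_trans _ _ 1); last by rewrite ler1n.
  by rewrite -[leRHS]mulr1 ler_pM// ltW.
have [Q Q0 /andP[Qlo Qhi]] := root_bracket n X1.
have QR : 0 < Q%:R ^+ n.+1 :> R by rewrite exprn_gt0// ltr0n.
have [q [p [q0 hq xq]]] := Bad_near_rational Q0 Bx.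
have xr j : `|x 0 j - ratpoint R q p 0 j| <= r / 4.
  apply: le_trans (xq j) _.
  move: Qlo; rewrite ler_pdivrMr ?mulr_gt0// => Qlo.
  have cQ0 : 0 < c ^+ n * Q%:R ^+ n.+1 by rewrite (mulr_gt0 cn0 QR).
  rewrite -div1r ler_pdivrMr//.
  have -> : r / 4 * (c ^+ n * Q%:R ^+ n.+1) = Q%:R ^+ n.+1 * (c ^+ n * r) / 4 by field.
  by rewrite ler_pdivlMr// mul1r.
(* Since [height q <= Q ^ n.+1 <= 2 ^ n.+3 / (c ^ n * r)] and [r = M * l], this is exactly what
   [M_large] provides. *)
have far : l < c / height R n' q.
  have h0 : 0 < height R n' q by rewrite powR_gt0// ltr0n.
  rewrite ltr_pdivlMr// mulrC -ltr_pdivlMr//.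
  apply: (le_lt_trans hq); apply: (le_lt_trans Qhi).
  rewrite mulrA ltr_pdivrMr ?mulr_gt0//.
  have -> : c / l * (c ^+ n * r) = M%:R * c ^+ n.+1.
    rewrite rl [c ^+ n.+1]exprS; move: (c ^+ n) => a; field.
    by rewrite gt_eqF.
  by apply: le_lt_trans M_large; rewrite [leRHS]exprSr [2 ^+ n.+2]exprSr; lra.
have M8R : 8 <= M%:R :> R by rewrite ler_nat.
have half1 : M%:R - 1 <= 2 * (M./2)%:R :> R.
  by rewrite lerBlDr -natrM natr1 ler_nat; case/andP: (half_bounds M).
have half2 : 2 * (M./2)%:R <= M%:R :> R by rewrite -natrM ler_nat; case/andP: (half_bounds M).
have qw : cell z 1 w (ratpoint R q p).
  move=> j; have := xb0 j; rewrite /= ffunE /= -/k lE rE.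
  rewrite -natr1 natrD natrM => lohi.
  rewrite -natr1 [X in _ <= _ <= X]mulrDl mul1r.
  apply: (@central_bounds _ _ ((M./2)%:R * l) l r (x 0 j - z 0 j)).
  - by rewrite rl -{2}[l]mul1r -mulrBl mulrA ler_pM2r.
  - by rewrite rl mulrA ler_pM2r.
  - by rewrite rl ler_pM2r.
  - by rewrite opprB addrA subrK; exact: xr.
  - by move: lohi; rewrite rl !mulrDl mul1r !mulrA !addrA.
have [b qb] := cell_cons_cover M_gt0 ltr01 qw.
exists b; rewrite -subset0 => y [By yb].
have := By q p q0; rewrite leNgt => /negP; apply.
apply: le_lt_trans far; apply/rV_norm_leP => [|j]; first exact: ltW.
have := cell_dist M_gt0 ltr01 yb qb j.
by rewrite /= -/k lE !mxE.
Qed.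

(** Subdividing [i] times and dropping a free child each time leaves a cover by [(M ^ n - 1) ^ i]
    cells. *)
Lemma premeasure_Bad_cell (z : 'rV[R]_n) (s d : R) (i : nat) (w : seq digit) :
  0 <= s -> cell_side M 1 (size w + i) <= d ->
  (hausdorff_premeasure s d (@Bad R n c `&` cell z 1 w) <=
    ((M ^ n - 1)%:R ^+ i * cell_side M 1 (size w + i) `^ s)%:E)%E.
Proof.
move=> s0; elim: i w => [|i IH] w.
  rewrite addn0 => wd.
  have dw : (diam (@Bad R n c `&` cell z 1 w) <= (cell_side M 1 (size w))%:E)%E.
    apply/diam_leP => x y [_ xw] [_ yw].
    apply/rV_norm_leP => [|j]; first by rewrite ltW// cell_side_gt0.
    by rewrite !mxE; exact: cell_dist xw yw j.
  rewrite expr0 mul1r; apply: le_trans (hgauge_le s0 dw).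
  by apply: hausdorff_premeasure_le_gauge; apply: le_trans dw _; rewrite lee_fin.
move=> wd; have [b0 Hb0] := free_child z w.
have sub : @Bad R n c `&` cell z 1 w `<=`
    \big[setU/set0]_(b | b != b0) (@Bad R n c `&` cell z 1 (b :: w)).
  move=> x [Bx xw]; have [b xb] := cell_cons_cover M_gt0 ltr01 xw.
  have bb0 : b != b0.
    apply/eqP => bb0; suff : (set0 : set 'rV[R]_n) x by [].
    by rewrite -Hb0 -bb0.
  by rewrite (bigD1 b)//=; left.
apply: le_trans (le_hausdorff_premeasure _ _ sub) _.
apply: le_trans (hausdorff_premeasure_bigsetU _ _ _ _) _.
apply: (@le_trans _ _ (\sum_(b | b != b0)
    ((M ^ n - 1)%:R ^+ i * cell_side M 1 (size w + i.+1) `^ s)%:E)%E).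
  by apply: lee_sum => b _; move: (IH (b :: w)); rewrite /= addSnnS; exact.
rewrite sumEFin sumr_const cardC1 card_ffun !card_ord -subn1.
by rewrite lee_fin exprS -mulrA mulr_natl.
Qed.

(** Countably many integer unit cubes cover the space, and in each the premeasure is at most
    [theta ^ i] for all large [i], where [theta < 1]. *)
Lemma hausdorff_measure_Bad_eq0 (s : R) : 0 <= s ->
  (M ^ n - 1)%:R < M%:R `^ s -> hausdorff_measure s (@Bad R n c) = 0%E.
Proof.
move=> s0 Ms; apply/hausdorff_measure_eq0P => d d0.
have MR : 0 < M%:R :> R by rewrite ltr0n.
pose center (t : {ffun 'I_n -> int}) : 'rV[R]_n := \row_j (t j)%:~R.
have cover : @Bad R n c `<=` \bigcup_t (@Bad R n c `&` cell (center t) 1 ([::] : seq digit)).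
  move=> x Bx; exists [ffun j => Num.floor (x 0 j)] => //; split=> // j.
  have /andP[lo hi] := floor_itv (x 0 j).
  rewrite !mxE ffunE /= /cell_side expr0 divr1 mul0r mul1r; apply/andP; split.
    by rewrite subr_ge0.
  by move: hi; rewrite intrD; lra.
apply/eqP; rewrite eq_le hausdorff_premeasure_ge0 andbT.
apply: le_trans (le_hausdorff_premeasure _ _ cover) _.
rewrite hausdorff_premeasure_null_bigcup// => t.
apply/eqP; rewrite eq_le hausdorff_premeasure_ge0 andbT.
pose theta : R := (M ^ n - 1)%:R / M%:R `^ s.
have theta0 : 0 <= theta by rewrite divr_ge0// powR_ge0.
have theta1 : theta < 1 by rewrite ltr_pdivrMr ?powR_gt0// mul1r.
have sideE i : (M ^ n - 1)%:R ^+ i * cell_side M (1 : R) i `^ s = theta ^+ i.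
  rewrite /theta expr_div_n; congr (_ * _).
  rewrite /cell_side div1r -powR_invn ?ltW// -powRrM mulNr powRN mulrC powRrM.
  by rewrite powR_mulrn ?powR_ge0.
apply/lee_addgt0Pr => e e0; rewrite add0e.
have small (a eps : R) : 0 <= a -> a < 1 -> 0 < eps -> \forall i \near \oo, a ^+ i <= eps.
  move=> a0 a1 eps0.
  have a_lt1 : `|a| < 1 by rewrite ger0_norm.
  have /cvgrPdist_le/(_ eps eps0) := cvg_expr a_lt1.
  apply: filterS => i; rewrite sub0r normrN ger0_norm ?exprn_ge0//.
have M1 : M%:R^-1 < 1 :> R by rewrite invf_lt1// ltr1n (leq_trans _ M8).
have [i [id ie]] : exists i, cell_side M 1 i <= d /\ theta ^+ i <= e.
  have : \forall i \near \oo, cell_side M 1 i <= d /\ theta ^+ i <= e.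
    near=> i; split; last by near: i; exact: small.
    rewrite /cell_side div1r -exprVn; near: i; apply: small => //.
  by case=> N _ /(_ N (leqnn N)); exists N.
apply: le_trans (@premeasure_Bad_cell (center t) s d i [::] s0 id) _.
by rewrite lee_fin add0n sideE.
Unshelve. all: by end_near. Qed.

End UpperBound.

(** * Dimension estimates *)

Lemma hausdorff_dim_Bad_ge (R : realType) (n' : nat) : let n := n'.+1 in
  exists kl t0 : R, [/\ 0 < kl, 0 <= t0 & forall t, t0 < t ->
    ((n%:R - kl / (t * expR (t / (2 * n%:R))))%:E
       <= hausdorff_dim (@Bad R n (expR (- t / n%:R))))%E].
Proof.
move=> n; pose K := (4 * n.+1`!)%N; pose D := (n + 2 * n.+1 * K).+2.
have n0 : 0 < n%:R :> R by rewrite ltr0n.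
have K0 : 0 < K%:R :> R by rewrite ltr0n muln_gt0 fact_gt0.
have D0 : 0 < D%:R :> R by rewrite ltr0n.
(* With [ln M >= t / (4 * n)] and [E <= 2 * M], this [kl] yields [kl / (t * E) * ln M >= 4 * D / E
   >= 2 * D / M]. The threshold on [t] ensures [E > K + 2 * D + 2]. *)
exists (16 * n%:R * D%:R), (2 * n%:R * (K%:R + 2 * D%:R + 2)).
split; [by rewrite !mulr_gt0|by rewrite mulr_ge0 ?mulr_ge0 ?addr_ge0 ?mulr_ge0//|].
move=> t t_large; set c := expR (- t / n%:R); set E := expR (t / (2 * n%:R)).
have E_large : K%:R + 2 * D%:R + 2 < E.
  apply: lt_le_trans (expR_ge1Dx _).
  rewrite -ltrBlDl ltr_pdivlMr ?mulr_gt0//.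
  by apply: le_lt_trans t_large; rewrite [leRHS]mulrC ler_wpM2r ?mulr_ge0 ?ltW//; lra.
have E0 : 0 < E by exact: expR_gt0.
have cE : c * E ^+ 2 = 1.
  rewrite expr2 /c /E -!expRD.
  have -> : - t / n%:R + (t / (2 * n%:R) + t / (2 * n%:R)) = 0.
    by field; rewrite gt_eqF.
  exact: expR0.
pose M := Num.truncn E.
have /andP[ME EM] : M%:R <= E < M.+1%:R by apply: truncn_itv; exact: ltW.
rewrite -natr1 in EM.
have MD : 2 * D%:R <= M%:R :> R by lra.
have M2E : E <= 2 * M%:R by lra.
have MR : 0 < M%:R :> R by lra.
have c0 : 0 < c by exact: expR_gt0.
have M1 : (1 < M)%N by rewrite -(ltr_nat R); lra.
have cM2 : c * M%:R ^+ 2 <= 1.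
  by rewrite -[leRHS]cE ler_pM2l// lerXn2r// nnegrE ltW.
have cKM : c * (K * M)%:R <= 1.
  rewrite -[leRHS]cE ler_pM2l// natrM expr2; apply: ler_pM => //; lra.
have t0 : 0 < t by apply: le_lt_trans t_large; rewrite !mulr_ge0 ?addr_ge0 ?mulr_ge0.
(* [M >= E / 2] and [E = u * u] with [u = expR (t / (4 * n)) >= 2], hence [M >= u]. *)
have lnM : t / (4 * n%:R) <= ln M%:R.
  rewrite -[leLHS]expRK ler_ln ?posrE ?expR_gt0//.
  set u := expR _; have u0 : 0 < u by exact: expR_gt0.
  have uE : u * u = E by rewrite -expRD; congr expR; field; rewrite gt_eqF.
  have D2 : 2 <= D%:R :> R by rewrite ler_nat.
  have E4 : 4 <= E by lra.
  have {E4}u2 : 2 <= u.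
    rewrite -(@ler_pXn2r _ 2)// ?nnegrE ?(ltW u0)//.
    by rewrite [leRHS]expr2 uE expr2; lra.
  have : 2 * u <= E by rewrite -uE ler_pM2r.
  lra.
apply: le_ereal_inf_tmp => _ [s [s0 Hs] <-]; rewrite lee_fin leNgt; apply/negP => sn.
have := @hausdorff_measure_Bad_neq0 R n' M c M1 c0 cM2 cKM s s0.
rewrite -/K -/D Hs eqxx => H; suff : false by [].
apply: H; first by rewrite -(ler_nat R) natrM.
have MD' : (D <= M)%N by rewrite -(ler_nat R); lra.
rewrite natrM natrX natrB//.
(* Twice the removed proportion [D / M]; the factor 2 makes room for
   [expR (- a) <= (1 + a)^-1 <= 1 - a / 2], valid for [0 < a <= 1]. *)
pose a : R := 2 * D%:R / M%:R.
have a0 : 0 < a by rewrite divr_gt0// mulr_gt0.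
have a1 : a <= 1 by rewrite ler_pdivrMr// mul1r.
have lna : a <= (n%:R - s) * ln M%:R.
  apply: (@le_trans _ _ (16 * n%:R * D%:R / (t * E) * (t / (4 * n%:R)))).
    have -> : 16 * n%:R * D%:R / (t * E) * (t / (4 * n%:R)) = 4 * D%:R / E.
      by field; rewrite !gt_eqF.
    rewrite ler_pdivlMr// /a mulrAC ler_pdivrMr// -!mulrA.
    by have := ler_wpM2l (ltW D0) M2E; lra.
  apply: ler_pM => //; [|by rewrite divr_ge0// ?mulr_ge0 ?ltW|lra].
  by rewrite !divr_ge0 ?mulr_ge0 ?ltW.
rewrite (_ : s = n%:R + (s - n%:R)); last lra.
rewrite powRD; last by apply/implyP => _; rewrite gt_eqF.
rewrite powR_mulrn//.
have -> : M%:R ^+ n' * (M%:R - D%:R) = M%:R ^+ n * (1 - D%:R / M%:R) :> R.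
  by rewrite [M%:R ^+ n]exprS; field; rewrite gt_eqF.
rewrite ler_pM2l ?exprn_gt0//.
rewrite /powR gt_eqF//.
apply: (@le_trans _ _ (expR (- a))); first by rewrite ler_expR; lra.
rewrite expRN.
apply: (@le_trans _ _ (1 + a)^-1).
  by rewrite lef_pV2 ?posrE ?expR_gt0 ?expR_ge1Dx//; lra.
have -> : D%:R / M%:R = a / 2 by rewrite /a; field; rewrite gt_eqF.
rewrite -div1r ler_pdivrMr; last lra.
nra.
Qed.

Lemma hausdorff_dim_Bad_le (R : realType) (n' : nat) : let n := n'.+1 in
  exists ku t0 : R, [/\ 0 < ku, 0 <= t0 & forall t, t0 < t ->
    (hausdorff_dim (@Bad R n (expR (- t / n%:R)))
       <= (n%:R - ku / (t * expR ((n%:R + 1) * t)))%:E)%E].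
Proof.
move=> n; have n0 : 0 < n%:R :> R by rewrite ltr0n.
have n1 : 1 <= n%:R :> R by rewrite ler1n.
(* [C] will give [M <= C * F], its spare factor 2 absorbing the rounding in [M]; [C'] will give
   [ln M <= C' * t], using [C <= expR (C * t)] for [t > 1]. *)
pose C : R := 2 ^+ n.+4; pose C' : R := C + (n%:R + 1) / n%:R.
have C0 : 0 < C by rewrite exprn_gt0.
have C1 : 1 <= C by rewrite exprn_ege1// ler1n.
have C'1 : 1 <= C' by rewrite /C' -[leLHS]addr0 lerD// divr_ge0 ?addr_ge0// ltW.
have Cn1 : 1 <= C ^+ n by rewrite exprn_ege1.
pose ku := (2 * C ^+ n * C')^-1.
have ku0 : 0 < ku by rewrite invr_gt0 !mulr_gt0//; lra.
have ku1 : ku <= 1.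
  by rewrite invf_le1 ?mulr_gt0//; nra.
exists ku, 1; split=> // t t1.
set c := expR (- t / n%:R); set G := expR ((n%:R + 1) * t).
pose F := expR ((n%:R + 1) / n%:R * t).
have FG : F ^+ n = G.
  by rewrite -expRM_natl; congr expR; field; rewrite gt_eqF.
have cF : c ^+ n.+1 * F = 1.
  rewrite -expRM_natl -expRD -[n.+1%:R]natr1.
  have -> : (n%:R + 1) * (- t / n%:R) + (n%:R + 1) / n%:R * t = 0.
    by field; rewrite gt_eqF.
  exact: expR0.
have F1 : 1 <= F by rewrite -expR0 ler_expR mulr_ge0 ?divr_ge0//; lra.
have G0 : 0 < G by exact: expR_gt0.
have G1 : 1 <= G by rewrite -FG exprn_ege1.
have c0 : 0 < c by exact: expR_gt0.
have c1 : c <= 1 by rewrite -expR0 ler_expR mulNr oppr_le0 divr_ge0//; lra.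
pose M := (Num.truncn (2 ^+ n.+3 * F)).+1.
have H0 : 0 <= 2 ^+ n.+3 * F by rewrite mulr_ge0 ?exprn_ge0//; lra.
have MF : 2 ^+ n.+3 * F < M%:R by exact: truncnS_gt.
have M_large : 2 ^+ n.+3 < M%:R * c ^+ n.+1.
  have cn0 : 0 < c ^+ n.+1 by exact: exprn_gt0.
  have E : 2 ^+ n.+3 * F * c ^+ n.+1 = 2 ^+ n.+3.
    by rewrite -mulrA [F * _]mulrC cF mulr1.
  by rewrite -[ltLHS]E ltr_pM2r.
have MCF : M%:R <= C * F.
  have /andP[lo _] := truncn_itv H0.
  have P1 : 1 <= 2 ^+ n.+3 * F.
    by rewrite -[leLHS]mulr1 ler_pM// exprn_ege1// ler1n.
  rewrite /M -natr1 /C [2 ^+ n.+4]exprS; lra.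
have MR : 0 < M%:R :> R by rewrite ltr0n.
have MnG : M%:R ^+ n <= C ^+ n * G.
  rewrite -FG -exprMn; apply: lerXn2r MCF; rewrite nnegrE//.
  by apply: mulr_ge0; [exact: ltW|lra].
have lnM : ln M%:R <= C' * t.
  rewrite -[leRHS]expRK ler_ln ?posrE ?expR_gt0//; apply: (le_trans MCF).
  rewrite /C' mulrDl expRD -/F; apply: ler_wpM2r; first lra.
  apply: le_trans (expR_ge1Dx _).
  have := ler_wpM2l (ltW C0) (ltW t1); lra.
pose s := n%:R - ku / (t * G).
have kut : ku / (t * G) <= 1.
  by rewrite ler_pdivrMr ?mulr_gt0//; nra.
have s0 : 0 <= s by rewrite /s; lra.
apply: ereal_inf_lbound; exists s => //; split=> //.
apply: (hausdorff_measure_Bad_eq0 c0 c1 M_large s0).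
rewrite natrB ?expn_gt0// natrX /s.
(* [M ^ s = M ^ n * expR (- a) >= M ^ n * (1 - a)], so [M ^ n * a < 1] suffices; [ku] makes this
   product at most 1/2, by [M ^ n <= C ^ n * G] and [ln M <= C' * t]. *)
pose a := ku / (t * G) * ln M%:R.
have aM : M%:R ^+ n * a < 1.
  have lnM0 : 0 <= ln M%:R :> R by rewrite ln_ge0// ler1n.
  have a_le : a <= (2 * C ^+ n * G)^-1.
    apply: (@le_trans _ _ (ku / (t * G) * (C' * t))).
      by apply: ler_wpM2l => //; rewrite divr_ge0 ?mulr_ge0//; lra.
    rewrite /ku le_eqVlt; apply/orP; left; apply/eqP.
    by field; rewrite !gt_eqF//; lra.
  have a0 : 0 <= a by rewrite mulr_ge0// divr_ge0 ?mulr_ge0//; lra.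
  have := ler_pM (exprn_ge0 n (ltW MR)) a0 MnG a_le.
  have -> : C ^+ n * G * (2 * C ^+ n * G)^-1 = 2^-1.
    by field; rewrite !gt_eqF//; lra.
  lra.
rewrite powRD; last by apply/implyP => _; rewrite gt_eqF.
rewrite powR_mulrn//.
rewrite [X in _ * X]/powR gt_eqF// mulNr -/a.
apply: (@lt_le_trans _ _ (M%:R ^+ n * (1 - a))); first lra.
by rewrite ler_pM2l ?exprn_gt0// expR_ge1Dx.
Qed.

Theorem theorem1p2 (R : realType) (n : nat) (hn : (1 <= n)%N) :
  exists kl ku t0 : R,
    [/\ 0 < kl, 0 < ku, 0 <= t0 &
      forall t : R, t0 < t ->
        ((n%:R - kl / (t * expR (t / (2 * n%:R))))%:E
           <= hausdorff_dim (@Bad R n (expR (- t / n%:R))))%E /\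
        (hausdorff_dim (@Bad R n (expR (- t / n%:R)))
           <= (n%:R - ku / (t * expR ((n%:R + 1) * t)))%:E)%E].
Proof.
case: n hn => // n' _.
have [kl [t1 [kl0 t10 H1]]] := hausdorff_dim_Bad_ge R n'.
have [ku [t2 [ku0 t20 H2]]] := hausdorff_dim_Bad_le R n'.
exists kl, ku, (Num.max t1 t2); split=> // [|t].
  by rewrite le_max t10.
by rewrite gt_max => /andP[/H1 ? /H2 ?].
Qed.
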